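(* Let $n,k\ge1$, let $G$ be a directed monotone $\sigma$-complete po-group with interpolation, and let $E=\Gamma_{ea}(\mathbb Z\,\overrightarrow{\times}\,G,(k,0))$ be the corresponding $k$-perfect effect algebra. Then every $n$-dimensional spectral resolution $F:\mathbb R^n\to E$ with the ordering property can be extended to a unique $n$-dimensional observable on $E$, i.e. there is a unique $n$-dimensional observable $x$ on $E$ with $x((-\infty,t_1)\times\cdots\times(-\infty,t_n))=F(t_1,\ldots,t_n)$ for all $(t_1,\ldots,t_n)\in\mathbb R^n$.
   Context: All groups are Abelian and written additively. A po-group $G$ is monotone $\sigma$-complete if every non-decreasing sequence in $G$ bounded above has a supremum in $G$; it has interpolation if whenever $a_1,a_2\le b_1,b_2$ in $G$ there is $c\in G$ with $a_1,a_2\le c\le b_1,b_2$. $\mathbb Z\,\overrightarrow{\times}\,G$ is $\mathbb Z\times G$ with lexicographic order: $(m,g)\le(m',g')$ iff $m<m'$, or $m=m'$ and $g\le g'$. $\Gamma_{ea}(\mathbb Z\,\overrightarrow{\times}\,G,(k,0))$ is the interval effect algebra $[(0,0),(k,0)]$, in which $a+b$ is the group sum, defined when it is $\le(k,0)$; bottom $0=(0,0)$, top $1=(k,0)$. $E$ is the disjoint union of $E_0=\{0\}\times G^+$, $E_j=\{j\}\times G$ for $0<j<k$, and $E_k=\{k\}\times G^-$, where $G^+$ and $G^-$ are the sets of elements $\ge 0$ and $\le 0$ of $G$. Suprema and infima below are taken in $E$. For $s,t\in\mathbb R^n$, $s\ll t$ (equivalently $t\gg s$) means $s_i<t_i$ for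 all $i$; $s\le t$ and $s\wedge t$ are coordinatewise. For $F:\mathbb R^n\to E$ and reals $a\le b$, $\Delta_i(a,b)F$ is the function of the remaining variables $F(\ldots,t_{i-1},b,t_{i+1},\ldots)-F(\ldots,t_{i-1},a,t_{i+1},\ldots)$, computed in $\mathbb Z\,\overrightarrow{\times}\,G$. An $n$-dimensional spectral resolution on $E$ is a map $F:\mathbb R^n\to E$ such that: (i) (volume condition) $\Delta_1(a_1,b_1)\cdots\Delta_n(a_n,b_n)F\ge0$ for all reals $a_i\le b_i$; (ii) $\bigvee_{s\ll t}F(s)=F(t)$ for all $t\in\mathbb R^n$; (iii) $\bigwedge_{t_i\in\mathbb R}F(s_1,\ldots,s_{i-1},t_i,s_{i+1},\ldots,s_n)=0$ for each $i$ and all fixed values of the other variables; (iv) $\bigvee_{s\in\mathbb R^n}F(s)=1$; (v) for every characteristic point $\mathbf t^B$ of $F$, corresponding to a block $B\subseteq T_j$, the element $a_B=\bigwedge\{F(s): s\gg\mathbf t^B\}$ exists in $E$ and belongs to $E_j$. Here, for $j=1,\ldots,k$, $T_j=\{t\in\mathbb R^n: F(t)\in E_j\}$. On $T_j$ one puts $s\sim t$ iff $s\wedge t\in T_j$; for $F$ satisfying (i)–(iv) this is an equivalence relation, and its classes are called blocks. The characteristic point of a block $B$ is the coordinatewise infimum $\mathbf t^B$ of $B$; the characteristic points of $T_j$ are those of its blocks, and the characteristic points of $F$ are those of all the blocks of $T_1,\ldots,T_k$. $F$ has the ordering property if (1) every non-empty $T_j$, $j=1,\ldots,k$, has at most one characteristic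 point, and (2) whenever $0<i<j\le k$ and $\mathbf t_i,\mathbf t_j$ are characteristic points of $T_i$ and $T_j$, respectively, then $\mathbf t_i\le\mathbf t_j$. An $n$-dimensional observable on $E$ is a map $x:\mathcal B(\mathbb R^n)\to E$ on the Borel $\sigma$-algebra such that $x(\mathbb R^n)=1$; $x(A\cup B)=x(A)+x(B)$ (the sum being defined in $E$) for disjoint Borel sets $A,B$; and $x(\bigcup_iA_i)=\bigvee_i x(A_i)$ for every non-decreasing sequence $(A_i)_i$ of Borel sets. *)

(* Defs.v *)
From HB Require Import structures.
From mathcomp Require Import all_boot all_order all_algebra.
From mathcomp Require Import all_classical all_reals all_analysis.

Set Implicit Arguments.
Unset Strict Implicit.
Unset Printing Implicit Defensive.

Import Order.TTheory GRing.Theory Num.Theory.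
Import numFieldNormedType.Exports.

Local Open Scope classical_set_scope.
Local Open Scope ring_scope.

(* [porderZmodType] does not relate the order to the addition; a po-group is a
   [porderZmodType] that satisfies this law. *)
Definition po_group_law (G : porderZmodType) : Prop :=
  forall a b c : G, a <= b -> a + c <= b + c.

Definition directed (G : porderZmodType) : Prop :=
  forall a b : G, exists2 c, a <= c & b <= c.

Definition interpolation (G : porderZmodType) : Prop :=
  forall a1 a2 b1 b2 : G,
    a1 <= b1 -> a1 <= b2 -> a2 <= b1 -> a2 <= b2 ->
    exists c, [/\ a1 <= c, a2 <= c, c <= b1 & c <= b2].

Definition monotone_sigma_complete (G : porderZmodType) : Prop :=
  forall u : nat -> G, nondecreasing_seq u -> has_ubound (range u) ->
    supremums (range u) !=set0.

Section IntervalEffectAlgebra.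
Variable G : porderZmodType.

(* [ring_display] makes the lexicographic order available as [<=] in
   [ring_scope], with [Zlex] again a [porderZmodType]. *)
Definition Zlex : Type := int *lexi[ring_display] G.
HB.instance Definition _ := Order.POrder.on Zlex.
HB.instance Definition _ := GRing.Zmodule.copy Zlex (int * G)%type.

Lemma Zlex_leE (a b : Zlex) :
  (a <= b) = (a.1 < b.1) || (a.1 == b.1) && (a.2 <= b.2).
Proof.
have -> : (a <= b) = (a.1 <= b.1) && ((b.1 <= a.1) ==> (a.2 <= b.2)) by [].
by case: (ltgtP a.1 b.1).
Qed.

Variable k : nat.

Definition Zlex_unit : Zlex := (k%:Z, 0).

Lemma Zlex_unit_ge0 : 0 <= Zlex_unit.
Proof. by rewrite Zlex_leE /=; case: k => [|m] /=; rewrite ?lexx ?orbT. Qed.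

Definition Gamma_ea : Type := {a : Zlex | 0 <= a <= Zlex_unit}.
HB.instance Definition _ := SubType.on Gamma_ea.
HB.instance Definition _ := Choice.on Gamma_ea.
HB.instance Definition _ :=
  [SubChoice_isSubPOrder of Gamma_ea by <: with ring_display].

Lemma Gamma_ea_bot_subproof : 0 <= (0 : Zlex) <= Zlex_unit.
Proof. by rewrite lexx Zlex_unit_ge0. Qed.
Definition Gamma_ea_bot : Gamma_ea := Sub 0 Gamma_ea_bot_subproof.

Lemma Gamma_ea_top_subproof : 0 <= Zlex_unit <= Zlex_unit.
Proof. by rewrite lexx Zlex_unit_ge0. Qed.
Definition Gamma_ea_top : Gamma_ea := Sub Zlex_unit Gamma_ea_top_subproof.

(* E_j; the bounds [0 <= a <= (k, 0)] that define the type already force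
   E_0 = {0} x G^+ and E_k = {k} x G^-. *)
Definition layer (j : nat) : set Gamma_ea := [set a | (val a).1 = j%:Z].

End IntervalEffectAlgebra.

Section Coordinatewise.
Variables (R : realType) (n : nat).
Implicit Types s t : 'rV[R]_n.

Definition cw_le s t : Prop := forall i, s 0 i <= t 0 i.
Definition cw_lt s t : Prop := forall i, s 0 i < t 0 i.
Definition cw_min s t : 'rV[R]_n := \row_i Num.min (s 0 i) (t 0 i).

Definition update t (i : 'I_n) (c : R) : 'rV[R]_n :=
  \row_j if j == i then c else t 0 j.

Definition borel : set (set 'rV[R]_n) := <<s open >>.

(* A function of the remaining variables is a function on R^n that does not
   depend on the i-th coordinate. *)
Definition Delta (H : zmodType) (i : 'I_n) (a b : R) (f : 'rV[R]_n -> H) :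
    'rV[R]_n -> H :=
  fun t => f (update t i b) - f (update t i a).

Definition Delta_all (H : zmodType) (a b : 'rV[R]_n) (f : 'rV[R]_n -> H) :
    'rV[R]_n -> H :=
  foldr (fun i => Delta i (a 0 i) (b 0 i)) f (enum 'I_n).

End Coordinatewise.

Section SpectralResolution.
Variables (R : realType) (n k : nat) (G : porderZmodType).
Variable F : 'rV[R]_n -> Gamma_ea G k.

Definition T_ (j : nat) : set 'rV[R]_n := F @^-1` layer j.

(* The classes of s ~ t on T_j. *)
Definition is_block (j : nat) (B : set 'rV[R]_n) : Prop :=
  exists2 t, T_ j t & B = [set s | T_ j s /\ T_ j (cw_min s t)].

(* When (i)-(iv) below hold, every block is bounded below in each coordinate,
   so this infimum exists. *)
Definition is_char_point_of (B : set 'rV[R]_n) (t : 'rV[R]_n) : Prop :=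
  forall i, infimums [set s 0 i | s in B] (t 0 i).

Definition is_char_point (j : nat) (t : 'rV[R]_n) : Prop :=
  exists2 B, is_block j B & is_char_point_of B t.

Definition volume_condition : Prop :=
  forall a b : 'rV[R]_n, cw_le a b ->
  forall t, 0 <= Delta_all a b (fun s => val (F s)) t.

Record is_spectral_resolution : Prop := {
  sr_volume : volume_condition;
  sr_left_continuous : forall t,
    supremums [set F s | s in [set s | cw_lt s t]] (F t);
  sr_inf : forall (i : 'I_n) (s : 'rV[R]_n),
    infimums (range (fun c : R => F (update s i c))) (Gamma_ea_bot G k);
  sr_sup : supremums (range F) (Gamma_ea_top G k);
  sr_char : forall (j : nat) (B : set 'rV[R]_n) (t : 'rV[R]_n),
    (1 <= j <= k)%N -> is_block j B -> is_char_point_of B t ->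
    exists2 a, infimums [set F s | s in [set s | cw_lt t s]] a & layer j a
}.

Definition ordering_property : Prop :=
  (forall j : nat, (1 <= j <= k)%N -> T_ j !=set0 ->
     forall s t, is_char_point j s -> is_char_point j t -> s = t) /\
  (forall (i j : nat) s t, (0 < i)%N -> (i < j <= k)%N ->
     is_char_point i s -> is_char_point j t -> cw_le s t).

End SpectralResolution.

(* An observable is a total function on sets of which only the values on Borel
   sets are meaningful. The equation in [obs_add] is an equation in Z x G; since
   its left-hand side lies below (k, 0), the sum is defined in the effect
   algebra. *)
Record is_observable (R : realType) (n k : nat) (G : porderZmodType)
    (x : set 'rV[R]_n -> Gamma_ea G k) : Prop := {
  obs_total : x setT = Gamma_ea_top G k;
  obs_add : forall A B : set 'rV[R]_n, borel A -> borel B ->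
    A `&` B = set0 -> val (x (A `|` B)) = val (x A) + val (x B);
  obs_sup : forall A : nat -> set 'rV[R]_n, (forall m, borel (A m)) ->
    (forall m, A m `<=` A m.+1) ->
    supremums (range (x \o A)) (x (\bigcup_m A m))
}.

(* Main.v *)
Require Import Defs.
From mathcomp Require Import all_boot all_order all_algebra.
From mathcomp Require Import all_classical all_reals all_analysis.
From mathcomp Require Import lra zify.

Set Implicit Arguments.
Unset Strict Implicit.
Unset Printing Implicit Defensive.

Import Order.TTheory GRing.Theory Num.Theory.
Import numFieldNormedType.Exports.

Local Open Scope classical_set_scope.
Local Open Scope ring_scope.

(** A spectral resolution splits as [F = (lev, gpart)]. The integer part [lev] is
    the distribution function of finitely many unit point masses, which by the
    ordering property sit at the characteristic points. By condition (v) the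
    [G]-parts of the volumes of small boxes around such a point are bounded below;
    subtracting lower bounds as masses at these points from [gpart] leaves a
    function [H] into the positive cone of [G] with nonnegative volumes, and it
    remains to extend [H] to a [G]-valued measure.

    [G] is archimedean. For countably many prescribed suprema and any [w] with
    [~ w <= 0], a Rasiowa-Sikorski construction whose conditions are the elements
    that are not [<= 0] yields a filter [P] containing [w], and from it a monotone
    functional [phi_P] that is additive and preserves suprema on the prescribed
    data, with [phi_P w > 0]. Then [phi_P \o H] is a real distribution function, so
    it has a measure [rho_P], obtained as an image of Lebesgue measure on an
    interval. Call [g] the value of [A] if [phi_P g = rho_P A] for generic [P]: values
    are unique, the value of an orthant is given by [H], and the Borel sets with a
    value form a lambda-system. *)

(** * Po-groups *)

(** Two obstacles shape the proof. In the lexicographic order a box of positive integer volume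
    satisfies (i) whatever its [G]-part, so (i) controls [gpart] only on boxes free of atoms. Which
    lower bound (v) yields near an atom does not matter: the masses [gamma] removed there are added
    back in [extension]. Secondly, [G] need not be a lattice, so meets are replaced by sets of
    common lower bounds, and a filter is asked to meet only countably many dense sets, so its
    functional respects only countably many relations. Hence real distribution functions are
    examined at rational points alone, each identity is proved for a countable family of relations
    of its own, and no functional is ever fixed. An inequality [g <= g'] in [G] is recovered by
    contradiction: if it fails, [g - g'] is a condition, and some filter that respects all relations
    in use contains it and gives it a positive real value. The archimedean property is what excludes
    positive elements of value zero. *)

Section PoGroup.
Variable G : porderZmodType.
Hypothesis G_po : po_group_law G.
Implicit Types a b c x y w : G.

Lemma po_lerD2r c a b : (a + c <= b + c) = (a <= b).
Proof.
apply/idP/idP => [h|]; last exact: G_po.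
by move: (G_po (- c) h); rewrite !addrK.
Qed.

Lemma po_lerD2l c a b : (c + a <= c + b) = (a <= b).
Proof. by rewrite ![c + _]addrC po_lerD2r. Qed.

Lemma po_lerD a b c d : a <= b -> c <= d -> a + c <= b + d.
Proof. by move=> ab cd; apply: (@le_trans _ _ (b + c)); rewrite ?po_lerD2r ?po_lerD2l. Qed.

Lemma po_lerBlDr a b c : (a - b <= c) = (a <= c + b).
Proof. by rewrite -[LHS](po_lerD2r b) subrK. Qed.

Lemma po_lerBrDr a b c : (a <= b - c) = (a + c <= b).
Proof. by rewrite -[LHS](po_lerD2r c) subrK. Qed.

Lemma po_subr_ge0 a b : (0 <= b - a) = (a <= b).
Proof. by rewrite po_lerBrDr add0r. Qed.

Lemma po_lerN2 a b : (- a <= - b) = (b <= a).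
Proof. by rewrite -[LHS](po_lerD2r (a + b)) addrA addNr add0r [a + b]addrC addrA addNr add0r. Qed.

Lemma po_addr_ge0 a b : 0 <= a -> 0 <= b -> 0 <= a + b.
Proof. by move=> a0 b0; rewrite -[0]addr0; exact: po_lerD. Qed.

Lemma po_ler_wnDr a b : 0 <= b -> a <= a + b.
Proof. by move=> b0; rewrite -{1}[a]addr0 po_lerD2l. Qed.

Lemma po_mulrn_wge0 a m : 0 <= a -> 0 <= a *+ m.
Proof. by move=> a0; elim: m => [|m IH]; rewrite ?mulr0n // mulrS po_addr_ge0. Qed.

Lemma po_lerMn2r a b m : a <= b -> a *+ m <= b *+ m.
Proof. by move=> ab; elim: m => [|m IH]; rewrite ?mulr0n // !mulrS po_lerD. Qed.

Lemma supremumsD (u : nat -> G) s c :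
  supremums (range u) s -> supremums (range (fun j => u j + c)) (s + c).
Proof.
move=> [ub lub]; split.
  by move=> _ [j _ <-]; rewrite po_lerD2r; apply: ub; exists j.
move=> y yub; rewrite -po_lerBrDr; apply: lub => _ [j _ <-].
by rewrite po_lerBrDr; apply: yub; exists j.
Qed.

Lemma supremumsN (u : nat -> G) s :
  infimums (range u) s -> supremums (range (fun j => - u j)) (- s).
Proof.
move=> [lb glb]; split.
  by move=> _ [j _ <-]; rewrite po_lerN2; apply: lb; exists j.
move=> y yub; rewrite -(opprK y) po_lerN2; apply: glb => _ [j _ <-].
by rewrite -po_lerN2 opprK; apply: yub; exists j.
Qed.

(** For mixed indices [u i + u j *+ q] is at most [u l *+ q.+1] with [l] the larger index, so the
    iterated supremum reduces to the diagonal. *)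
Lemma supremums_mulrn (u : nat -> G) s q :
  nondecreasing_seq u -> supremums (range u) s ->
  supremums (range (fun j => u j *+ q)) (s *+ q).
Proof.
move=> ndu [ub lub]; elim: q => [|q [IH1 IH2]]; split.
- by move=> _ [j _ <-]; rewrite !mulr0n.
- by move=> y /(_ 0); rewrite mulr0n; apply; exists 0%N.
- by move=> _ [j _ <-]; rewrite !mulrS; apply: po_lerD; [apply: ub|apply: IH1]; exists j.
move=> y yub; rewrite mulrS -po_lerBrDr; apply: lub => _ [i _ <-].
rewrite po_lerBrDr addrC -po_lerBrDr; apply: IH2 => _ [j _ <-].
rewrite po_lerBrDr addrC.
apply: (@le_trans _ _ (u (maxn i j) *+ q.+1)); last by apply: yub; exists (maxn i j).
by rewrite mulrS; apply: po_lerD; [|apply: po_lerMn2r]; apply: ndu; rewrite ?leq_maxl ?leq_maxr.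
Qed.

Hypothesis G_msc : monotone_sigma_complete G.

Lemma decreasing_inf (v : nat -> G) y : nonincreasing_seq v -> lbound (range v) y ->
  infimums (range v) !=set0.
Proof.
move=> niv lb.
have [] := G_msc (u := fun j => - v j).
- by move=> i j ij; rewrite po_lerN2 niv.
- by exists (- y) => _ [j _ <-]; rewrite po_lerN2; apply: lb; exists j.
move=> s [ub lub]; exists (- s); split.
  by move=> _ [j _ <-]; rewrite -po_lerN2 opprK; apply: ub; exists j.
move=> z zlb; rewrite -(opprK z) po_lerN2; apply: lub => _ [j _ <-].
by rewrite po_lerN2; apply: zlb; exists j.
Qed.

Hypothesis G_int : interpolation G.

(** Iterated interpolation gives a decreasing sequence above [a1] and [a2] whose term [j] is below
    [b j]; its infimum, which exists by monotone sigma-completeness, works for all [j] at once. *)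
Lemma countable_interpolation a1 a2 (b : nat -> G) :
  (forall j, a1 <= b j) -> (forall j, a2 <= b j) ->
  exists c, [/\ a1 <= c, a2 <= c & forall j, c <= b j].
Proof.
move=> h1 h2.
have step : forall (c : {c : G | a1 <= c /\ a2 <= c}) (j : nat),
    {d : {c : G | a1 <= c /\ a2 <= c} | sval d <= sval c /\ sval d <= b j}.
  move=> [c [c1 c2]] j; apply: cid.
  by have [d [d1 d2 d3 d4]] := G_int c1 (h1 j) c2 (h2 j); exists (exist _ d (conj d1 d2)).
pose c := fix c j : {c : G | a1 <= c /\ a2 <= c} :=
  if j is i.+1 then sval (step (c i) i.+1) else exist _ (b 0%N) (conj (h1 0%N) (h2 0%N)).
have niv : nonincreasing_seq (fun j => sval (c j)).
  by apply/nonincreasing_seqP => j /=; case: (svalP (step (c j) j.+1)).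
have lb z : (z = a1 \/ z = a2) -> lbound (range (fun j => sval (c j))) z.
  by move=> [] -> _ [j _ <-]; case: (svalP (c j)).
have [s [slb sglb]] := decreasing_inf niv (lb a1 (or_introl erefl)).
exists s; split; try by apply: sglb; apply: lb; tauto.
move=> j; apply: (@le_trans _ _ (sval (c j))); first by apply: slb; exists j.
by case: j => [|j] //=; case: (svalP (step (c j) j.+1)).
Qed.

(* The hypotheses [d + m a <= b] for all [m] let interpolation build an
   increasing [d_i] with [d_i + a <= d_(i+1)]; then [sup d_i + a <= sup d_i]. *)
Lemma archimedean_nonneg a b : (forall m, a *+ m <= b) -> a <= 0.
Proof.
move=> ab.
pose I := {d : G | forall m, d + a *+ m <= b}.
have step : forall d : I, {e : I | sval d <= sval e /\ sval d + a <= sval e}.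
  move=> [d hd]; apply: cid => /=.
  have [c [c1 c2 c3]] : exists c, [/\ d <= c, d + a <= c & forall m, c <= b - a *+ m].
    apply: countable_interpolation => m; first by rewrite po_lerBrDr.
    by rewrite po_lerBrDr -addrA -mulrS.
  have hc m : c + a *+ m <= b by rewrite -po_lerBrDr.
  by exists (exist _ c hc).
have h0 m : 0 + a *+ m <= b by rewrite add0r.
pose d := fix d j : I := if j is i.+1 then sval (step (d i)) else exist _ 0 h0.
have [] := G_msc (u := fun j => sval (d j)).
- by apply/nondecreasing_seqP => j /=; case: (svalP (step (d j))).
- by exists b => _ [j _ <-]; have := svalP (d j) 0%N; rewrite mulr0n addr0.
move=> s [sub slub]; rewrite -(po_lerD2l s) addr0 -po_lerBrDr.
apply: slub => _ [j _ <-]; rewrite po_lerBrDr.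
apply: (@le_trans _ _ (sval (d j.+1))); last by apply: sub; exists j.+1.
by rewrite /=; case: (svalP (step (d j))).
Qed.

End PoGroup.

Definition archimedean (G : porderZmodType) : Prop :=
  forall a b : G, (forall m, a *+ m <= b) -> a <= 0.

(** * Generic filters *)

Section GenericFilters.
Variable G : porderZmodType.
Hypothesis G_po : po_group_law G.
Hypothesis G_dir : directed G.
Hypothesis G_arch : archimedean G.
Implicit Types a b v w x y : G.

(* [w] forces the positivity of [v] when [w <= v]; [w <= 0] would force a
   contradiction. *)
Definition condition w := ~~ (w <= 0).

Definition dense (D : set G) :=
  forall w, condition w -> exists w', [/\ w' <= w, condition w' & D w'].

Record is_filter (P : set G) : Prop := {
  filter_cond : forall v, P v -> condition v;
  filter_up : forall v v', P v -> v <= v' -> P v';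
  filter_dir : forall v v', P v -> P v' -> exists x, [/\ P x, x <= v & x <= v'] }.

(** The analogue of holding on a comeager set: it survives countable conjunctions, and every
    condition lies in some filter that satisfies it. *)
Definition generically (Q : set G -> Prop) :=
  exists2 D : nat -> set G, (forall i, dense (D i)) &
    forall P, is_filter P -> (forall i, P `&` D i !=set0) -> Q P.

(** A descending chain from [w] enters the dense sets one after another; its upward closure is the
    filter. *)
Lemma generically_ex (Q : set G -> Prop) w :
  generically Q -> condition w -> exists P, [/\ is_filter P, P w & Q P].
Proof.
move=> [D Dd DQ] cw.
have step : forall (c : {c : G | condition c}) (i : nat),
    {d : {c : G | condition c} | sval d <= sval c /\ D i (sval d)}.
  move=> [c cc] i; apply: cid.
  by have [d [d1 d2 d3]] := Dd i c cc; exists (exist _ d d2).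
pose c := fix c j : {c : G | condition c} :=
  if j is i.+1 then sval (step (c i) i) else exist _ w cw.
have niv : nonincreasing_seq (fun j => sval (c j)).
  by apply/nonincreasing_seqP => j /=; case: (svalP (step (c j) j)).
pose P := [set v | exists j, sval (c j) <= v].
have Pc j : P (sval (c j)) by exists j.
have fP : is_filter P.
  split.
  - move=> v [j jv]; apply/negP => v0; have := svalP (c j).
    by rewrite /condition (le_trans jv v0).
  - by move=> v v' [j jv] vv'; exists j; exact: le_trans vv'.
  - move=> v v' [i iv] [j jv]; exists (sval (c (maxn i j))); split => //.
      by apply: le_trans iv; apply: niv; exact: leq_maxl.
    by apply: le_trans jv; apply: niv; exact: leq_maxr.
exists P; split => //; first exact: (Pc 0%N).
apply: DQ => // i; exists (sval (c i.+1)); split => //.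
by rewrite /=; case: (svalP (step (c i) i)).
Qed.

Lemma generically_sub (Q Q' : set G -> Prop) :
  generically Q -> (forall P, is_filter P -> Q P -> Q' P) -> generically Q'.
Proof. by move=> [D Dd DQ] QQ'; exists D => // P fP mP; exact: QQ' (DQ _ _ _). Qed.

Lemma generically_all (I : countType) (Q : I -> set G -> Prop) :
  (forall i, generically (Q i)) -> generically (fun P => forall i, Q i P).
Proof.
move=> h; pose D i := sval (cid2 (h i)).
have [Dd DQ] : (forall i j, dense (D i j)) /\ (forall i P, is_filter P ->
    (forall j, P `&` D i j !=set0) -> Q i P).
  by split => i; rewrite /D; case: (cid2 (h i)).
pose E m := if unpickle m is Some (i, j) then D i j else setT.
have cE (i : I) (j : nat) : E (pickle (i, j)) = D i j by rewrite /E pickleK.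
exists E.
  by move=> m; rewrite /E; case: unpickle => [[i j]|] // w cw; exists w.
by move=> P fP mP i; apply: DQ => // j; rewrite -cE.
Qed.

Lemma generically_and (Q Q' : set G -> Prop) :
  generically Q -> generically Q' -> generically (fun P => Q P /\ Q' P).
Proof.
move=> h h'; have H (b : bool) : generically (if b then Q else Q') by case: b.
apply: generically_sub (generically_all H) _.
by move=> P _ hP; split; [exact: (hP true)|exact: (hP false)].
Qed.

Lemma generically_true (Q : set G -> Prop) :
  (forall P, is_filter P -> Q P) -> generically Q.
Proof. by move=> h; exists (fun=> setT) => [_ w cw|P fP _]; [exists w|exact: h]. Qed.

(** Density is only needed below [v]: conditions incompatible with [v] are added to the set by hand,
    and a filter through [v] contains none of them. *)
Lemma generically_dense v (D : set G) :
  (forall w, condition w -> w <= v -> exists w', [/\ w' <= w, condition w' & D w']) ->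
  generically (fun P => P v -> exists2 w, P w & D w).
Proof.
move=> h.
pose E := [set w | D w \/ forall x, x <= w -> x <= v -> x <= 0].
exists (fun=> E).
  move=> _ w cw; have [[x [xw xv cx]]|no] :=
      pselect (exists x, [/\ x <= w, x <= v & condition x]).
    have [w' [w'x cw' Dw']] := h x cx xv.
    by exists w'; split => //; [exact: le_trans xw|left].
  exists w; split => //; right => x xw xv; apply/negPn/negP => cx.
  by apply: no; exists x.
move=> P fP /(_ 0%N) [w [Pw [Dw|no]]] Pv; first by exists w.
have [x [Px xw xv]] := filter_dir fP Pw Pv.
by have := filter_cond fP Px; rewrite /condition no.
Qed.

(** With a meet [x] of [0] and [v] this would be cancellation in [x + w <= x]. Instead, [w]
    translates the common lower bounds of [0] and [v] into themselves, so all multiples of [w] stay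
    below [- y], and [G] is archimedean. *)
Lemma arch_shift w v : (exists y, y <= 0 /\ y <= v) ->
  (forall y, y <= 0 -> y <= v -> y + w <= 0 /\ y + w <= v) -> w <= 0.
Proof.
move=> [y [y0 yv]] h.
have hm m : y + w *+ m <= 0 /\ y + w *+ m <= v.
  elim: m => [|m [IH1 IH2]]; first by rewrite mulr0n addr0.
  by rewrite mulrSr addrA; exact: h.
apply: (@G_arch _ (- y)) => m.
by rewrite -(po_lerD2l G_po y) subrr; case: (hm m).
Qed.

Lemma directed_lower v : exists y, y <= 0 /\ y <= v.
Proof.
have [c c0 cv] := G_dir 0 (- v); exists (- c).
by rewrite -(po_lerN2 G_po) opprK oppr0 -(po_lerN2 G_po v) opprK.
Qed.

(** If no condition lay below both [w] and [w + w], adding [w] would preserve the common lower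
    bounds of [0] and [w], so [arch_shift] would apply. *)
Lemma condition_double w : condition w ->
  exists w', [/\ w' <= w, condition w' & w' <= w + w].
Proof.
move=> cw; apply: contrapT => no; move/negP: cw; apply.
have h x : x <= w -> x <= w + w -> x <= 0.
  by move=> xw xww; apply/negPn/negP => cx; apply: no; exists x.
apply: (@arch_shift w w (directed_lower w)) => y y0 yw.
have yw0 : y + w <= 0 by apply: h; rewrite ?po_lerD2r // -{2}[w]add0r po_lerD2r.
by split => //; rewrite -{2}[w]add0r po_lerD2r.
Qed.

(** Otherwise [w] would preserve the common lower bounds [y] of [0] and [- v]: [y + w] lies below
    [w] and [v'], hence is [<= 0]; then [y + w + v] lies below [w] and [v], hence is [<= 0] too. *)
Lemma condition_split w v v' : condition w -> w <= v + v' ->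
  exists w', [/\ w' <= w, condition w' & w' <= v \/ w' <= v'].
Proof.
move=> cw wvv; apply: contrapT => no; move/negP: cw; apply.
have h x : x <= w -> x <= v \/ x <= v' -> x <= 0.
  by move=> xw xvv; apply/negPn/negP => cx; apply: no; exists x.
apply: (@arch_shift w (- v) (directed_lower (- v))) => y y0 yv.
have yw : y + w <= w by rewrite -{2}[w]add0r po_lerD2r.
have yw0 : y + w <= 0.
  apply: h => //; right; apply: (@le_trans _ _ (- v + (v + v'))).
    exact: (po_lerD G_po).
  by rewrite addrA addNr add0r.
split => //; rewrite -(po_lerD2r G_po v) addNr.
apply: h.
  by rewrite addrAC -[leRHS]add0r po_lerD2r // -(addNr v) po_lerD2r.
by left; rewrite -[leRHS]add0r po_lerD2r.
Qed.

Lemma generic_split a b : generically (fun P => P (a + b) -> P a \/ P b).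
Proof.
apply: generically_sub (generically_dense
  (v := a + b) (D := [set w | w <= a \/ w <= b]) _) _.
  by move=> w cw wab; exact: condition_split.
move=> P fP h /h [w Pw [wa|wb]]; [left|right]; exact: filter_up fP _ _ Pw _.
Qed.

(** Below a common extension [x] of [a] and [b], doubling gives a condition under [x + x], hence
    under [a + b]. *)
Lemma generic_add a b : generically (fun P => P a -> P b -> P (a + b)).
Proof.
pose D := [set w | w <= a + b \/ forall x, x <= w -> x <= b -> x <= 0].
have : generically (fun P => P a -> exists2 w, P w & D w).
  apply: generically_dense => w cw wa.
  have [[x [xw xb cx]]|no] := pselect (exists x, [/\ x <= w, x <= b & condition x]).
    have [y [yx cy yxx]] := condition_double cx; exists y; split => //.
      exact: le_trans xw.
    left; apply: le_trans yxx _; apply: (po_lerD G_po) => //; exact: le_trans wa.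
  exists w; split => //; right => x xw xb; apply/negPn/negP => cx.
  by apply: no; exists x.
move/generically_sub; apply => P fP h /h [w Pw [wab|no]] Pb.
  exact: filter_up fP _ _ Pw _.
have [x [Px xw xb]] := filter_dir fP Pw Pb.
by have := filter_cond fP Px; rewrite /condition no.
Qed.

(** The witness [b j + (w - s)] lies below [w] and below [b j]. Were it never a condition, [s - w]
    would bound every [b j], hence [s], and [w <= 0]. *)
Lemma generic_sup (b : nat -> G) s : supremums (range b) s ->
  generically (fun P => P s -> exists j, P (b j)).
Proof.
move=> [ub lub].
have : generically (fun P => P s -> exists2 w, P w & [set w | exists j, w <= b j] w).
  apply: generically_dense => w cw ws; apply: contrapT => no.
  move/negP: cw; apply; have h j : b j + (w - s) <= 0.
    apply/negPn/negP => cx; apply: no; exists (b j + (w - s)); split => //.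
      rewrite addrCA -{2}[w]addr0 po_lerD2l // po_lerBlDr // add0r.
      by apply: ub; exists j.
    by exists j; rewrite -{2}[b j]addr0 po_lerD2l // po_lerBlDr // add0r.
  have : s <= - (w - s).
    apply: lub => _ [j _ <-].
    by rewrite -(po_lerD2r G_po (w - s)) addNr.
  by rewrite -(po_lerD2r G_po (w - s) s) addNr addrCA subrr addr0.
move/generically_sub; apply => P fP h /h [w Pw [j wj]].
by exists j; exact: filter_up fP _ _ Pw wj.
Qed.

Lemma generic_muln v q : generically (fun P => P v -> P (v *+ q.+1)).
Proof.
elim: q => [|q IH]; first by apply: generically_true => P _; rewrite mulr1n.
apply: generically_sub (generically_and IH (generic_add v (v *+ q.+1))) _.
by move=> P fP [h1 h2] Pv; rewrite mulrS; exact: h2 (h1 Pv).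
Qed.

Lemma generic_divn v q : generically (fun P => P (v *+ q) -> P v).
Proof.
elim: q => [|q IH].
  by apply: generically_true => P fP /(filter_cond fP); rewrite mulr0n /condition lexx.
apply: generically_sub (generically_and IH (generic_split v (v *+ q))) _.
by move=> P fP [h1 h2]; rewrite mulrS => /h2 [//|/h1].
Qed.

(** Rules out infinitesimal elements of the filter; this is what makes [state P v] strictly positive
    when [P v]. *)
Lemma generic_arch v u : 0 <= u ->
  generically (fun P => P v -> exists m, P (v *+ m.+1 - u)).
Proof.
move=> u0.
have : generically (fun P => P v ->
   exists2 w, P w & [set w | exists m, w <= v *+ m.+1 - u] w).
  apply: generically_dense => w cw wv.
  have [m cm] : exists m, condition (w *+ m.+1 - u).
    apply: contrapT => no; move/negP: cw; apply.
    apply: (@G_arch _ u) => -[|m]; first by rewrite mulr0n.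
    rewrite -(po_lerD2r G_po (- u)) subrr; apply/negPn/negP => cx.
    by apply: no; exists m.
  (* The condition just found need not lie below [w], but it lies below a multiple of [w], from
     which [condition_split] peels off one summand at a time. *)
  have : exists w', [/\ w' <= w *+ m.+1 - u, condition w' & w' <= w].
    have : w *+ m.+1 - u <= w *+ m.+1.
      by rewrite po_lerBlDr //; exact: po_ler_wnDr.
    move: {2}(m.+1) => q.
    move: (w *+ m.+1 - u) cm => x; elim: q x => [|q IH] x cx xq.
      by move: cx; rewrite /condition -(mulr0n w) xq.
    move: xq; rewrite mulrS => /(condition_split cx) [x' [x'x cx' [x'w|x'q]]].
      by exists x'.
    have [x'' [h1 h2 h3]] := IH x' cx' x'q.
    by exists x''; split => //; exact: le_trans x'x.
  move=> [w' [w'm cw' w'w]]; exists w'; split => //; exists m.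
  by apply: le_trans w'm _; rewrite po_lerD2r //; exact: po_lerMn2r.
move/generically_sub; apply => P fP h /h [w Pw [m wm]].
by exists m; exact: filter_up fP _ _ Pw wm.
Qed.

End GenericFilters.

Lemma ratr_frac (R : archiRealFieldType) (r : rat) :
  exists p q, ratr r = p%:~R / q.+1%:R :> R.
Proof.
exists (numq r), `|denq r|.-1; rewrite prednK ?absz_gt0 ?denq_neq0 //.
by rewrite /ratr pmulrn absz_denq.
Qed.

(** * Real functionals of generic filters *)

Section State.
Variables (R : realType) (G : porderZmodType).
Hypothesis G_po : po_group_law G.
Hypothesis G_dir : directed G.
Hypothesis G_arch : archimedean G.
Variable u : G.
Hypothesis u_ge0 : 0 <= u.
Implicit Types (a b v : G) (P : set G).

(* [P (excess v q p)] reads [v > (p / q.+1) u] in the preorder given by [P]. *)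
Definition excess v (q : nat) (p : int) : G := v *+ q.+1 - u *~ p.

Definition state_set P v : set R :=
  [set r | exists p q, P (excess v q p) /\ r = p%:~R / q.+1%:R].

Definition state P v : R := sup (state_set P v).

(** For these elements, and a filter through [u], the cut [state_set] is nonempty and bounded;
    elsewhere [sup] could be a mere default. *)
Definition ubounded v := exists m, - (u *+ m) <= v /\ v <= u *+ m.

Lemma ubounded_itv v : 0 <= v -> v <= u -> ubounded v.
Proof.
move=> v0 vu; exists 1%N; rewrite mulr1n; split => //.
by apply: le_trans v0; rewrite -[leRHS]oppr0 po_lerN2.
Qed.

Lemma uboundedD a b : ubounded a -> ubounded b -> ubounded (a + b).
Proof.
move=> [m [m1 m2]] [p [p1 p2]]; exists (m + p)%N.
by rewrite mulrnDr opprD; split; exact: po_lerD.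
Qed.

Lemma uboundedN a : ubounded a -> ubounded (- a).
Proof. by move=> [m [m1 m2]]; exists m; rewrite po_lerN2 // -{2}[u *+ m]opprK po_lerN2. Qed.

Lemma po_mulrz_ge0 (p : int) : 0 <= p -> 0 <= u *~ p.
Proof. by case: p => // p _; exact: po_mulrn_wge0. Qed.

Lemma po_ler_mulrz (p q : int) : p <= q -> u *~ p <= u *~ q.
Proof.
move=> pq; rewrite -(subrK p q) mulrzDr -{1}[u *~ p]add0r po_lerD2r //.
by apply: po_mulrz_ge0; rewrite subr_ge0.
Qed.

Lemma state_set_has_sup P v : is_filter P -> P u -> ubounded v ->
  has_sup (state_set P v).
Proof.
move=> fP Pu [m [m1 m2]]; split.
  (* Adding [u *+ m.+1] to [v] gives an element above [u], and [u] is in [P]. *)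
  exists ((- m.+1%:Z)%:~R / 1%:R); exists (- m.+1%:Z), 0%N; split => //.
  apply: filter_up fP _ _ Pu _; rewrite /excess mulr1n mulrNz opprK.
  by rewrite -pmulrn mulrS addrCA po_ler_wnDr // -(addNr (u *+ m)) po_lerD2r.
exists m%:R => _ [p [q [Ppq ->]]].
rewrite ler_pdivrMr ?ltr0n // leNgt; apply/negP => lt.
have := filter_cond fP Ppq; rewrite /condition => /negP; apply.
rewrite /excess po_lerBlDr // add0r.
apply: (@le_trans _ _ (u *+ m *+ q.+1)); first exact: po_lerMn2r.
rewrite -mulrnA pmulrn; apply: po_ler_mulrz; apply/ltW.
by move: lt; rewrite -natrM -[(_ * _)%:R]/((m * q.+1)%N%:Z%:~R) ltr_int.
Qed.

Lemma le_state P a b : is_filter P -> P u -> ubounded a -> ubounded b ->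
  a <= b -> state P a <= state P b.
Proof.
move=> fP Pu ua ub ab; apply: ge_sup.
  by case: (state_set_has_sup fP Pu ua).
move=> r [p [q [Ppq ->]]]; apply: ub_le_sup.
  by case: (state_set_has_sup fP Pu ub).
exists p, q; split => //; apply: filter_up fP _ _ Ppq _.
by rewrite /excess po_lerD2r //; exact: po_lerMn2r.
Qed.

Lemma state_ge0 P a : is_filter P -> P u -> ubounded a -> 0 <= a ->
  0 <= state P a.
Proof.
move=> fP Pu ua a0; have [_ hs] := state_set_has_sup fP Pu ua.
rewrite leNgt; apply/negP => s0.
have := ltr_add_invr s0 => -[q hq].
suff : - q.+1%:R^-1 <= state P a.
  by rewrite lerNl leNgt -subr_lt0 opprK addrC hq.
apply: ub_le_sup => //; exists (-1), q; split; last by rewrite mulrN1z mulN1r.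
apply: filter_up fP _ _ Pu _; rewrite /excess mulrN1z opprK -{1}[u]add0r.
by rewrite po_lerD2r //; exact: po_mulrn_wge0.
Qed.

Lemma excessMD a b p q p' q' :
  excess a q p *+ q'.+1 + excess b q' p' *+ q.+1 =
  excess (a + b) (q.+1 * q'.+1).-1 (p * q'.+1%:Z + p' * q.+1%:Z).
Proof.
rewrite /excess prednK ?muln_gt0 // !mulrnBl -!mulrnA mulrnDl mulrzDr opprD.
by rewrite addrACA [(q'.+1 * _)%N]mulnC !mulrzA -!pmulrn.
Qed.

(** Makes [state_set] a true lower cut of the rationals, independent of the fraction chosen;
    multiplication and division by integers inside [P] clear the denominators. *)
Lemma generic_state_set_le v : generically (fun P => forall x : int * nat * int * nat,
  let: (p, q, p', q') := x in p' * q.+1%:Z <= p * q'.+1%:Z ->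
  P (excess v q p) -> P (excess v q' p')).
Proof.
apply: generically_all => -[[[p q] p'] q'].
apply: generically_sub (generically_and
  (generic_muln G_po G_dir G_arch (excess v q p) q')
  (generic_divn G_po G_dir G_arch (excess v q' p') q.+1)) _.
move=> P fP [h1 h2] le /h1 Pm; apply: h2; apply: filter_up fP _ _ Pm _.
rewrite /excess !mulrnBl -!mulrnA [(q'.+1 * _)%N]mulnC po_lerD2l // po_lerN2 //.
by rewrite !pmulrn -!mulrzA; apply: po_ler_mulrz.
Qed.

(** Closure of [P] under addition gives one inequality. For the other, rationals slightly above the
    two states would have a sum still reached by [a + b], and splitting would make one of them
    reached by its summand. *)
Lemma generic_stateD a b : ubounded a -> ubounded b ->
  generically (fun P => P u -> state P (a + b) = state P a + state P b).
Proof.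
move=> ba bb; have bab := uboundedD ba bb.
have g1 : generically (fun P => forall x : int * nat * int * nat,
    let: (p, q, p', q') := x in P (excess a q p) -> P (excess b q' p') ->
    P (excess a q p *+ q'.+1 + excess b q' p' *+ q.+1)).
  apply: generically_all => -[[[p q] p'] q'].
  apply: generically_sub (generically_and (generically_and
    (generic_muln G_po G_dir G_arch (excess a q p) q')
    (generic_muln G_po G_dir G_arch (excess b q' p') q))
    (generic_add G_po G_dir G_arch (excess a q p *+ q'.+1) (excess b q' p' *+ q.+1))) _.
  by move=> P fP [[h1 h2] h3] /h1 + /h2; exact: h3.
have g2 : generically (fun P => forall x : int * nat * int * nat,
    let: (p, q, p', q') := x in
    P (excess a q p *+ q'.+1 + excess b q' p' *+ q.+1) ->
    P (excess a q p) \/ P (excess b q' p')).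
  apply: generically_all => -[[[p q] p'] q'].
  apply: generically_sub (generically_and (generically_and
    (generic_divn G_po G_dir G_arch (excess a q p) q'.+1)
    (generic_divn G_po G_dir G_arch (excess b q' p') q.+1))
    (generic_split G_po G_dir G_arch (excess a q p *+ q'.+1) (excess b q' p' *+ q.+1))) _.
  by move=> P fP [[h1 h2] h3] /h3 [/h1|/h2]; [left|right].
apply: generically_sub (generically_and (generically_and g1 g2)
  (generic_state_set_le (a + b))) _.
move=> P fP [[h1 h2] h3] Pu.
have [sa sb] := (state_set_has_sup fP Pu ba, state_set_has_sup fP Pu bb).
have sab := state_set_has_sup fP Pu bab.
apply/eqP; rewrite eq_le; apply/andP; split; last first.
  rewrite /state -sup_sumE //; apply: ge_sup.
    have [[[x xa] _] [[y yb] _]] := (sa, sb).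
    by exists (x + y); exists x => //; exists y.
  move=> _ [_ [p [q [Pa ->]]] [_ [p' [q' [Pb ->]]] <-]].
  apply: ub_le_sup; first by case: sab.
  exists (p * q'.+1%:Z + p' * q.+1%:Z), (q.+1 * q'.+1).-1; split.
    by rewrite -excessMD; exact: (h1 (p, q, p', q')).
  by rewrite prednK ?muln_gt0 // rmorphD !rmorphM /= natrM addf_div ?pnatr_eq0.
apply: ge_sup; first by case: sab.
move=> _ [p [q [Pab ->]]]; rewrite leNgt; apply/negP => lt.
pose e := (p%:~R / q.+1%:R - (state P a + state P b)) / 2.
have e0 : 0 < e by rewrite divr_gt0 // subr_gt0.
have [|ra] := @rat_in_itvoo R (state P a) (state P a + e); first by rewrite ltrDl.
rewrite in_itv /= => /andP[ra1 ra2].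
have [|rb] := @rat_in_itvoo R (state P b) (state P b + e); first by rewrite ltrDl.
rewrite in_itv /= => /andP[rb1 rb2].
have [p1 [q1 Ea]] := ratr_frac R ra; have [p2 [q2 Eb]] := ratr_frac R rb.
have nPa : ~ P (excess a q1 p1).
  move=> Pa; move: ra1; rewrite Ea ltNge => /negP; apply.
  by apply: ub_le_sup; [case: sa|exists p1, q1].
have nPb : ~ P (excess b q2 p2).
  move=> Pb; move: rb1; rewrite Eb ltNge => /negP; apply.
  by apply: ub_le_sup; [case: sb|exists p2, q2].
suff : P (excess (a + b) (q1.+1 * q2.+1).-1 (p1 * q2.+1%:Z + p2 * q1.+1%:Z)).
  by rewrite -excessMD => /(h2 (p1, q1, p2, q2)) [].
apply: (h3 (p, q, p1 * q2.+1%:Z + p2 * q1.+1%:Z, (q1.+1 * q2.+1).-1)) => //.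
rewrite prednK ?muln_gt0 // PoszM -(ler_int R) !rmorphM rmorphD !rmorphM /=.
suff : ratr ra + ratr rb <= p%:~R / q.+1%:R :> R.
  rewrite Ea Eb addf_div ?pnatr_eq0 // ler_pdivrMr ?mulr_gt0 ?ltr0n //.
  by rewrite mulrAC ler_pdivlMr ?ltr0n.
apply/ltW; apply: (lt_le_trans (ltrD ra2 rb2)).
by rewrite addrACA /e -splitr addrC subrK.
Qed.

Lemma generic_stateB a b : ubounded a -> ubounded b ->
  generically (fun P => P u -> state P (a - b) = state P a - state P b).
Proof.
move=> ba bb; apply: generically_sub (generic_stateD (uboundedD ba (uboundedN bb)) bb) _.
by move=> P fP h /h; rewrite subrK => ->; rewrite addrK.
Qed.

Lemma generic_state_gt0 v : ubounded v ->
  generically (fun P => P u -> P v -> 0 < state P v).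
Proof.
move=> bv; apply: generically_sub (generic_arch G_po G_dir G_arch v u_ge0) _.
move=> P fP h Pu /h [m Pm]; apply: (@lt_le_trans _ _ (1%:~R / m.+1%:R)).
  by rewrite divr_gt0 ?ltr0n.
apply: ub_le_sup; first by case: (state_set_has_sup fP Pu bv).
by exists 1, m.
Qed.

(** Multiples and translates preserve suprema, so [excess s q p] is the supremum of the
    [excess (b j) q p]; if it is in [P], so is one of these. *)
Lemma generic_state_cvg (b : nat -> G) s : nondecreasing_seq b ->
  (forall j, ubounded (b j)) -> ubounded s -> supremums (range b) s ->
  generically (fun P => P u -> (state P (b j)) @[j --> \oo] --> state P s).
Proof.
move=> ndb bb bs sups.
have g : generically (fun P => forall x : int * nat, let: (p, q) := x in
    P (excess s q p) -> exists j, P (excess (b j) q p)).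
  apply: generically_all => -[p q]; apply: generic_sup => //.
  exact/supremumsD/supremums_mulrn.
apply: generically_sub g _ => P fP h Pu.
have ndS : nondecreasing_seq (fun j => state P (b j)).
  by move=> i j ij; apply: le_state => //; exact: ndb.
have leS j : state P (b j) <= state P s.
  by apply: le_state => //; case: sups => + _; apply; exists j.
have -> : state P s = sup (range (fun j => state P (b j))).
  apply/eqP; rewrite eq_le; apply/andP; split; last first.
    apply: ge_sup; first by exists (state P (b 0%N)); exists 0%N.
    by move=> _ [j _ <-].
  apply: ge_sup; first by case: (state_set_has_sup fP Pu bs).
  move=> _ [p [q [Ppq ->]]]; have [j Pj] := h (p, q) Ppq.
  apply: (@le_trans _ _ (state P (b j))).
    apply: ub_le_sup; first by case: (state_set_has_sup fP Pu (bb j)).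
    by exists p, q.
  apply: ub_le_sup; last by exists j.
  by exists (state P s) => _ [i _ <-].
apply: nondecreasing_cvgn => //.
by exists (state P s) => _ [i _ <-].
Qed.

End State.

(** * Volumes of boxes *)

Section Boxes.
Variables (R : realType) (n : nat).
Implicit Types (s t a b : 'rV[R]_n) (l : seq 'I_n).

Lemma update_eq t i c : update t i c 0 i = c.
Proof. by rewrite mxE eqxx. Qed.

Lemma update_neq t i j c : j != i -> update t i c 0 j = t 0 j.
Proof. by move=> /negbTE ji; rewrite mxE ji. Qed.

Lemma update_update t i c d : update (update t i c) i d = update t i d.
Proof. by apply/rowP => j; rewrite !mxE; case: eqP. Qed.

Lemma update_id t i : update t i (t 0 i) = t.
Proof. by apply/rowP => j; rewrite !mxE; case: eqP => [->|]. Qed.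

Lemma updateC t i j c d : i != j ->
  update (update t i c) j d = update (update t j d) i c.
Proof.
move=> ij; apply/rowP => k; rewrite !mxE; case: (eqVneq k j) => // ->.
by rewrite eq_sym (negbTE ij).
Qed.

Lemma cw_le_refl t : cw_le t t.
Proof. by []. Qed.

Lemma cw_le_trans s t r : cw_le s t -> cw_le t r -> cw_le s r.
Proof. by move=> h1 h2 i; exact: le_trans (h2 i). Qed.

Lemma cw_lt_le s t : cw_lt s t -> cw_le s t.
Proof. by move=> h i; exact: ltW. Qed.

Lemma cw_lt_le_trans s t r : cw_lt s t -> cw_le t r -> cw_lt s r.
Proof. by move=> h1 h2 i; exact: lt_le_trans (h2 i). Qed.

Lemma cw_le_lt_trans s t r : cw_le s t -> cw_lt t r -> cw_lt s r.
Proof. by move=> h1 h2 i; exact: le_lt_trans (h2 i). Qed.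

Lemma cw_minlr s t : cw_le (cw_min s t) t.
Proof. by move=> i; rewrite mxE ge_min lexx orbT. Qed.

Lemma cw_minll s t : cw_le (cw_min s t) s.
Proof. by move=> i; rewrite mxE ge_min lexx. Qed.

Lemma cw_min_l s t : cw_le s t -> cw_min s t = s.
Proof. by move=> h; apply/rowP => i; rewrite mxE; exact/min_idPl. Qed.

Lemma cw_lt_min s t r : cw_lt r (cw_min s t) <-> cw_lt r s /\ cw_lt r t.
Proof.
split=> [h|[h1 h2] i]; last by rewrite mxE lt_min h1 h2.
by split => i; have := h i; rewrite mxE lt_min => /andP[].
Qed.

Lemma cw_le_update t i c d : c <= d -> cw_le (update t i c) (update t i d).
Proof. by move=> cd j; rewrite !mxE; case: eqP. Qed.

Lemma cw_le_update2 s t i c d : c <= d -> cw_le s t ->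
  cw_le (update s i c) (update t i d).
Proof. by move=> cd st j; rewrite !mxE; case: eqP. Qed.

(** Partial differences are the volumes of boxes unbounded below in the remaining coordinates;
    inductions on the dimension run over [l]. *)
Definition Deltas (H : zmodType) l a b (f : 'rV[R]_n -> H) : 'rV[R]_n -> H :=
  foldr (fun i => Delta i (a 0 i) (b 0 i)) f l.

Section Linearity.
Variable H : zmodType.
Implicit Types f g : 'rV[R]_n -> H.

Lemma Deltas_cons i l a b f t : Deltas (i :: l) a b f t =
  Deltas l a b f (update t i (b 0 i)) - Deltas l a b f (update t i (a 0 i)).
Proof. by []. Qed.

Lemma eq_Deltas l a a' b b' f :
  {in l, forall i, a 0 i = a' 0 i} -> {in l, forall i, b 0 i = b' 0 i} ->
  Deltas l a b f = Deltas l a' b' f.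
Proof.
elim: l => //= i l IH ha hb.
rewrite IH => [|j jl|j jl]; try by [apply: ha; rewrite in_cons jl orbT|apply: hb; rewrite in_cons jl orbT].
by rewrite ha ?hb ?mem_head.
Qed.

Lemma eq_Deltas_fun l a b f g t : f =1 g -> Deltas l a b f t = Deltas l a b g t.
Proof. by move=> fg; congr (Deltas l a b _ t); exact/funext. Qed.

Lemma Deltas_morph (K : zmodType) (phi : H -> K) l a b f t :
  {morph phi : x y / x - y} ->
  Deltas l a b (phi \o f) t = phi (Deltas l a b f t).
Proof. by move=> phiB; elim: l t => //= i l IH t; rewrite /Delta !IH phiB. Qed.

Lemma DeltasB l a b f g t :
  Deltas l a b (fun s => f s - g s) t = Deltas l a b f t - Deltas l a b g t.
Proof.
elim: l t => //= i l IH t; rewrite /Delta !IH.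
by rewrite !opprB addrACA [RHS]addrACA; congr (_ + _); rewrite addrC.
Qed.

Lemma Deltas0 l a b t : Deltas l a b (fun=> 0 : H) t = 0.
Proof. by elim: l t => //= i l IH t; rewrite /Delta !IH subrr. Qed.

Lemma DeltasD l a b f g t :
  Deltas l a b (fun s => f s + g s) t = Deltas l a b f t + Deltas l a b g t.
Proof. by elim: l t => //= i l IH t; rewrite /Delta !IH opprD addrACA. Qed.

Lemma Deltas_sum (I : Type) (r : seq I) l a b (f : I -> 'rV[R]_n -> H) t :
  Deltas l a b (fun s => \sum_(i <- r) f i s) t = \sum_(i <- r) Deltas l a b (f i) t.
Proof.
elim: r => [|i r IH].
  by rewrite big_nil -[RHS](Deltas0 l a b t); apply: eq_Deltas_fun => s; rewrite big_nil.
by rewrite big_cons -IH -DeltasD; apply: eq_Deltas_fun => s; rewrite big_cons.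
Qed.

(** Each difference overwrites its own coordinate of the base point. *)
Lemma Deltas_base l a b f s t : {in [predC l], forall i, s 0 i = t 0 i} ->
  Deltas l a b f s = Deltas l a b f t.
Proof.
elim: l s t => /= [|i l IH] s t st.
  by congr f; apply/rowP => i; exact: st.
have h c : {in [predC l], forall j, update s i c 0 j = update t i c 0 j}.
  move=> j jl; rewrite !mxE; case: eqVneq => // ji.
  by apply: st; rewrite inE in_cons negb_or ji.
by rewrite /Delta (IH _ _ (h _)) (IH _ _ (h _)).
Qed.

Lemma Deltas_split_at i l a b a1 b1 a2 b2 f t : i \in l -> uniq l ->
  (forall g s, Delta i (a 0 i) (b 0 i) g s =
     Delta i (a1 0 i) (b1 0 i) g s + Delta i (a2 0 i) (b2 0 i) g s :> H) ->
  (forall j, j != i -> [/\ a1 0 j = a 0 j, a2 0 j = a 0 j, b1 0 j = b 0 j & b2 0 j = b 0 j]) ->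
  Deltas l a b f t = Deltas l a1 b1 f t + Deltas l a2 b2 f t.
Proof.
move=> + + splt off; elim: l t => // j l IH t; rewrite in_cons => + /andP[jl ul].
have [ij _|ij] := eqVneq i j.
  rewrite -{}ij in jl *.
  have lE : {in l, forall k, [/\ a1 0 k = a 0 k, a2 0 k = a 0 k, b1 0 k = b 0 k & b2 0 k = b 0 k]}.
    by move=> k kl; apply: off; apply: contraTneq kl => ->.
  have E1 : Deltas l a b f = Deltas l a1 b1 f by apply: eq_Deltas => k /lE[].
  have E2 : Deltas l a b f = Deltas l a2 b2 f by apply: eq_Deltas => k /lE[].
  by rewrite /= splt -/(Deltas l a b f) {1}E1 E2.
rewrite orFb => il; rewrite !Deltas_cons !IH //; have [|-> -> -> ->] := off j; first by rewrite eq_sym.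
by rewrite opprD addrACA.
Qed.

(* [min a b] makes the volume of an inverted box vanish, so that cutting a box
   is additive without side conditions. *)
Definition volume f a b : H := Deltas (enum 'I_n) (cw_min a b) b f 0.

Lemma volume_split i c f a b :
  volume f a b = volume f a (update b i (Num.min (b 0 i) c)) +
                 volume f (update a i (Num.max (a 0 i) c)) b.
Proof.
apply: (@Deltas_split_at i); rewrite ?mem_enum ?enum_uniq //.
  move=> g s; rewrite !mxE eqxx /Delta.
  set A := a 0 i; set B := b 0 i.
  have [Bc|cB] := leP B c.
    have -> : Num.min (Num.max A c) B = B.
      by apply/min_idPr; rewrite le_max Bc orbT.
    by rewrite subrr addr0.
  have [Ac|cA] := leP A c.
    have -> : Num.min c B = c by apply/min_idPl; exact/ltW.
    have -> : Num.min A B = A by apply/min_idPl; exact: le_trans (ltW cB).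
    by rewrite [RHS]addrC addrA subrK.
  by rewrite subrr add0r.
by move=> j ji; rewrite !mxE (negbTE ji).
Qed.

Lemma volume0 i f a b : b 0 i <= a 0 i -> volume f a b = 0.
Proof.
move=> ba; rewrite /volume.
have : i \in enum 'I_n by rewrite mem_enum.
elim: (enum 'I_n) (0 : 'rV_n) => // j l IH t; rewrite in_cons Deltas_cons.
have [<- _|ij] := eqVneq i j; last by rewrite orFb => il; rewrite !IH // subrr.
by rewrite mxE (min_idPr ba) subrr.
Qed.

Lemma volumeE f a b t : cw_le a b -> volume f a b = Deltas (enum 'I_n) a b f t.
Proof.
move=> ab; rewrite /volume cw_min_l //; apply: Deltas_base => i.
by rewrite inE mem_enum.
Qed.

End Linearity.

(** As [l] grows, [a] moves to [c] one coordinate at a time; monotonicity in all coordinates is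
    proved along this path. *)
Definition override l a (c : 'rV[R]_n) : 'rV[R]_n := \row_i if i \in l then c 0 i else a 0 i.

Lemma override_cons i l a c : override (i :: l) a c = update (override l a c) i (c 0 i).
Proof. by apply/rowP => j; rewrite !mxE in_cons; case: eqVneq => [->|]. Qed.

Lemma override_nil a c : override [::] a c = a.
Proof. by apply/rowP => j; rewrite !mxE. Qed.

Lemma override_enum a c : override (enum 'I_n) a c = c.
Proof. by apply/rowP => j; rewrite !mxE mem_enum. Qed.

End Boxes.

(** * Real distribution functions at rational points *)

Section RatPointVolumes.
Variables (R : realType) (n : nat) (h : 'rV[R]_n -> R) (C : R).
Implicit Types (s t a b q : 'rV[R]_n) (l : seq 'I_n).

(** A generic functional respects volumes at countably many corners only; the rational ones suffice
    to recover a measure. *)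
Definition rat_point t := forall i, exists r : rat, t 0 i = ratr r.

Lemma rat_point_update t i c : rat_point t -> (exists r : rat, c = ratr r) ->
  rat_point (update t i c).
Proof. by move=> rt rc j; rewrite mxE; case: eqP. Qed.

Lemma rat_point_min s t : rat_point s -> rat_point t -> rat_point (cw_min s t).
Proof. by move=> rs rt i; rewrite mxE; case: leP. Qed.

Lemma rat_point_override l s t : rat_point s -> rat_point t -> rat_point (override l s t).
Proof. by move=> rs rt i; rewrite mxE; case: ifP. Qed.

Lemma ratr_max (x y : R) : (exists r : rat, x = ratr r) -> (exists r : rat, y = ratr r) ->
  exists r : rat, Num.max x y = ratr r.
Proof. by case: leP. Qed.

Lemma ratr_min (x y : R) : (exists r : rat, x = ratr r) -> (exists r : rat, y = ratr r) ->
  exists r : rat, Num.min x y = ratr r.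
Proof. by case: leP. Qed.

Lemma ratr_nat_ex m : exists r : rat, m%:R = ratr r :> R.
Proof. by exists m%:R; rewrite ratr_nat. Qed.

Lemma ratr_natN_ex m : exists r : rat, - m%:R = ratr r :> R.
Proof. by exists (- m%:R); rewrite rmorphN /= ratr_nat. Qed.

Definition cube_lo (m : nat) : 'rV[R]_n := const_mx (- m%:R).
Definition cube_hi (m : nat) : 'rV[R]_n := const_mx m%:R.

Lemma rat_point_lo m : rat_point (cube_lo m).
Proof. by move=> i; rewrite mxE; exact: ratr_natN_ex. Qed.

Lemma rat_point_hi m : rat_point (cube_hi m).
Proof. by move=> i; rewrite mxE; exact: ratr_nat_ex. Qed.

Lemma near_cube_lo t : \forall m \near \oo, cw_le (cube_lo m) t.
Proof.
apply: filter_forall => i; near=> m; rewrite mxE lerNl.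
near: m; exact: nbhs_infty_ger.
Unshelve. all: by end_near. Qed.

Lemma near_cube_hi t : \forall m \near \oo, cw_le t (cube_hi m).
Proof.
apply: filter_forall => i; near=> m; rewrite mxE.
near: m; exact: nbhs_infty_ger.
Unshelve. all: by end_near. Qed.

Hypothesis h_vol : forall l a b t, uniq l ->
  rat_point a -> rat_point b -> rat_point t -> cw_le a b -> 0 <= Deltas l a b h t.
Hypothesis h_bnd : forall t, rat_point t -> h t <= C.
Hypothesis h_inf : forall i t, rat_point t -> h (update t i (- m%:R)) @[m --> \oo] --> 0.

Lemma Deltas_le l a b t : uniq l -> rat_point a -> rat_point b -> rat_point t ->
  cw_le a b -> Deltas l a b h t <= h (override l t b).
Proof.
move=> + ra rb + ab; elim: l t => [|i l IH] t; first by rewrite override_nil.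
move=> /andP[il ul] rt; rewrite Deltas_cons.
have -> : override (i :: l) t b = override l (update t i (b 0 i)) b.
  by apply/rowP => j; rewrite !mxE in_cons; case: eqVneq => [->|//] /=; case: ifP.
apply: le_trans (IH _ ul _); last exact: rat_point_update.
by rewrite gerBl h_vol //; exact: rat_point_update.
Qed.

Lemma volume_ge0 a b : rat_point a -> rat_point b -> 0 <= volume h a b.
Proof.
move=> ra rb; apply: h_vol; rewrite ?enum_uniq //; first exact: rat_point_min.
  by move=> i; exists 0; rewrite mxE rmorph0.
exact: cw_minlr.
Qed.

Lemma volume_le_bound a b : rat_point a -> rat_point b -> volume h a b <= C.
Proof.
move=> ra rb; apply: (@le_trans _ _ (h b)); last exact: h_bnd.
rewrite -[X in h X](override_enum 0); apply: Deltas_le; rewrite ?enum_uniq //.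
- exact: rat_point_min.
- by move=> i; exists 0; rewrite mxE rmorph0.
- exact: cw_minlr.
Qed.

(** One face at a time is moved outwards, and each move adds a slab of nonnegative volume. *)
Lemma le_volume a b a' b' : rat_point a -> rat_point b -> rat_point a' -> rat_point b' ->
  cw_le a' a -> cw_le b b' -> volume h a b <= volume h a' b'.
Proof.
move=> ra rb ra' rb' aa bb; apply: (@le_trans _ _ (volume h a b')).
  suff H l : volume h a (override l b' b) <= volume h a b'.
    by have := H (enum 'I_n); rewrite override_enum.
  elim: l => [|i l IH]; first by rewrite override_nil.
  apply: le_trans IH; have ro := rat_point_override l rb' rb.
  rewrite [leRHS](volume_split i (b 0 i)) override_cons.
  have -> : Num.min (override l b' b 0 i) (b 0 i) = b 0 i.
    by apply/min_idPr; rewrite mxE; case: ifP.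
  rewrite lerDl volume_ge0 //; apply: rat_point_update => //.
  exact: ratr_max.
suff H l : volume h (override l a' a) b' <= volume h a' b'.
  by have := H (enum 'I_n); rewrite override_enum.
elim: l => [|i l IH]; first by rewrite override_nil.
apply: le_trans IH; have ro := rat_point_override l ra' ra.
rewrite [leRHS](volume_split i (a 0 i)) override_cons.
have -> : Num.max (override l a' a 0 i) (a 0 i) = a 0 i.
  by apply/max_idPr; rewrite mxE; case: ifP.
rewrite lerDr volume_ge0 //; apply: rat_point_update => //.
exact: ratr_min.
Qed.

Lemma Deltas_cvg l q t : uniq l -> rat_point q -> rat_point t ->
  Deltas l (cube_lo m) q h t @[m --> \oo] --> h (override l t q).
Proof.
move=> + rq; elim: l t => [|i l IH] t.
  by move=> _ _; rewrite override_nil; exact: cvg_cst.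
move=> /andP[il ul] rt.
have -> : override (i :: l) t q = override l (update t i (q 0 i)) q.
  by apply/rowP => j; rewrite !mxE in_cons; case: eqVneq => [->|//] /=; case: ifP.
rewrite -[X in _ --> X]subr0.
under eq_fun do rewrite Deltas_cons.
apply: cvgB; first by apply: IH => //; exact: rat_point_update.
have ro := rat_point_override l rt rq.
(* By [Deltas_le] the lower face contributes at most [h] at a point whose coordinate [i] is [- m],
   which tends to [0]. *)
apply: (@squeeze_cvgr _ _ _ _ (fun=> 0) (fun m => h (update (override l t q) i (- m%:R)))).
- near=> m.
  have mq : cw_le (cube_lo m) q by near: m; exact: near_cube_lo.
  have ru : rat_point (update t i (cube_lo m 0 i)).
    by apply: rat_point_update => //; exact: rat_point_lo.
  rewrite h_vol //=; last exact: rat_point_lo.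
  rewrite (_ : update (override l t q) _ _ = override l (update t i (cube_lo m 0 i)) q).
    by apply: Deltas_le => //; exact: rat_point_lo.
  apply/rowP => j; rewrite !mxE; case: eqVneq => [->|//].
  by rewrite (negbTE il).
- exact: cvg_cst.
- exact: h_inf.
Unshelve. all: by end_near. Qed.

Lemma volume_cvg q : rat_point q ->
  volume h (cube_lo m) (cw_min (cube_hi m) q) @[m --> \oo] --> h q.
Proof.
move=> rq; have := @Deltas_cvg (enum 'I_n) q 0 (enum_uniq _) rq.
rewrite override_enum => /(_ _) H.
apply: cvg_trans (H _); last by move=> i; exists 0; rewrite mxE rmorph0.
apply: near_eq_cvg; near=> m.
have -> : cw_min (cube_hi m) q = q.
  apply/rowP => i; rewrite mxE; apply/min_idPr.
  by move: i; near: m; exact: near_cube_hi.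
rewrite (@volumeE _ _ _ _ _ _ 0) //; near: m; exact: near_cube_lo.
Unshelve. all: by end_near. Qed.

End RatPointVolumes.

(** * Borel sets and orthants *)

Section BorelOrthants.
Variables (R : realType) (n : nat).
Implicit Types (s t : 'rV[R]_n) (A B : set 'rV[R]_n).

Definition orthant t : set 'rV[R]_n := [set s | cw_lt s t].

Lemma setI_closed_orthants : setI_closed (range orthant).
Proof.
move=> _ _ [s _ <-] [t _ <-]; exists (cw_min s t) => //.
by apply/seteqP; split => r; rewrite /orthant /setI /= => /cw_lt_min.
Qed.

Lemma open_orthant t : open (orthant t).
Proof.
rewrite openE => s st; suff : \forall r \near s, cw_lt r t by [].
apply: (@filter_forall _ _ (fun i (r : 'rV[R]_n) => r 0 i < t 0 i) _ (nbhs_filter s)) => i.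
have : (fun r : 'rV[R]_n => r 0 i) @ s --> s 0 i by exact: coord_continuous.
by move/cvgr_lt; apply; exact: st.
Qed.

Let orthantType := g_sigma_algebraType (range orthant).

Let measurable_orthant t : measurable (orthant t : set orthantType).
Proof. by apply: sub_sigma_algebra; exists t. Qed.

Let measurable_half_space i (c : R) :
  measurable ([set s : 'rV[R]_n | s 0 i < c] : set orthantType).
Proof.
have -> : [set s : 'rV[R]_n | s 0 i < c] = \bigcup_m orthant (update (const_mx m%:R) i c); last first.
  by apply: bigcupT_measurable => m; exact: measurable_orthant.
apply/seteqP; split => [s /= sc|s [m _ /(_ i)]]; last by rewrite update_eq.
pose m := \max_(j < n) (Num.truncn (s ord0 j)).+1.
exists m => // j; rewrite mxE; case: eqVneq => [-> //|ji]; rewrite mxE.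
apply: (lt_le_trans (truncnS_gt (s 0 j))).
by rewrite ler_nat; exact: (@leq_bigmax _ (fun j : 'I_n => (Num.truncn (s ord0 j)).+1) j).
Qed.

Let measurable_box (a b : 'rV[R]_n) :
  measurable ([set s : 'rV[R]_n | cw_le a s /\ cw_lt s b] : set orthantType).
Proof.
have -> : [set s : 'rV[R]_n | cw_le a s /\ cw_lt s b] =
  \bigcap_(i in [set: 'I_n]) ~` [set s : 'rV[R]_n | s 0 i < a 0 i] `&` orthant b; last first.
  apply: measurableI; last exact: measurable_orthant.
  apply: fin_bigcap_measurable; first exact: finite_finset.
  by move=> i _; apply: measurableC; exact: measurable_half_space.
apply/seteqP; split => s [h1 h2]; split => // i; first by move=> _; apply/negP; rewrite -leNgt.
by have /negP := h1 i I; rewrite -leNgt.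
Qed.

(** An open set is the union of the half-open boxes with rational corners that it contains; the
    other boxes are replaced by the empty set, so that the union runs over a countable type. *)
Lemma borel_orthants : @borel R n = <<s range orthant>>.
Proof.
apply/seteqP; split; apply: smallest_sub; try exact: smallest_sigma_algebra.
  move=> U oU.
  pose box (p : {ffun 'I_n -> rat} * {ffun 'I_n -> rat}) : set orthantType :=
    [set s | cw_le (\row_i ratr (p.1 i)) s /\ cw_lt s (\row_i ratr (p.2 i))].
  rewrite (_ : U = \bigcup_p (if `[< box p `<=` U >] then box p else set0)).
    apply: (@countable_bigcupT_measurable _ orthantType) => // p.
    by case: ifP => // _; exact: measurable_box.
  apply/seteqP; split => [s Us|s [p _]]; last by case: asboolP => // h /h.
  have /nbhs_ballP[e /= e0 eU] : nbhs s U by move: oU; rewrite openE; exact.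
  have ha i : exists r : rat, s 0 i - e < ratr r < s 0 i.
    have [|r] := @rat_in_itvoo R (s 0 i - e) (s 0 i); first by rewrite gtrBl.
    by rewrite in_itv; exists r.
  have hb i : exists r : rat, s 0 i < ratr r < s 0 i + e.
    have [|r] := @rat_in_itvoo R (s 0 i) (s 0 i + e); first by rewrite ltrDl.
    by rewrite in_itv; exists r.
  pose p := ([ffun i => sval (cid (ha i))], [ffun i => sval (cid (hb i))]).
  exists p => //; case: asboolP => [_|[]].
    by split => i; rewrite mxE ffunE /=; [case: (cid (ha i))|case: (cid (hb i))] =>
      r /= /andP[h1 h2]; rewrite ?(ltW h2).
  move=> r [h1 h2]; apply: eU; split => // k i; rewrite (ord1 k).
  have := h1 i; have := h2 i; rewrite !mxE !ffunE /=.
  case: (cid (ha i)) => ra /= /andP[a1 a2]; case: (cid (hb i)) => rb /= /andP[b1 b2] c1 c2.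
  by rewrite /ball /= ltr_distlC; apply/andP; split; lra.
by move=> _ [t _ <-]; apply: sub_sigma_algebra; exact: open_orthant.
Qed.

Lemma borel_orthant t : borel (orthant t).
Proof. by rewrite borel_orthants; exact: measurable_orthant. Qed.

Lemma borelT : @borel R n setT.
Proof. by rewrite borel_orthants; exact: (@measurableT _ orthantType). Qed.

Lemma borelD A B : borel A -> borel B -> borel (A `\` B).
Proof. by rewrite borel_orthants; exact: (@measurableD _ orthantType). Qed.

Lemma borelU A B : borel A -> borel B -> borel (A `|` B).
Proof. by rewrite borel_orthants; exact: (@measurableU _ orthantType). Qed.

Lemma borel_bigcup (A : nat -> set 'rV[R]_n) :
  (forall m, borel (A m)) -> borel (\bigcup_m A m).
Proof. by rewrite borel_orthants; exact: (@bigcupT_measurable _ orthantType). Qed.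

(** Dynkin's lemma: orthants are closed under intersection, and the Borel sets in [Q] form a
    lambda-system. *)
Lemma borel_ind (Q : set (set 'rV[R]_n)) :
  Q setT -> (forall t, Q (orthant t)) ->
  (forall A B, B `<=` A -> borel A -> borel B -> Q A -> Q B -> Q (A `\` B)) ->
  (forall A : nat -> set 'rV[R]_n, nondecreasing_seq A ->
     (forall m, borel (A m)) -> (forall m, Q (A m)) -> Q (\bigcup_m A m)) ->
  @borel R n `<=` Q.
Proof.
move=> QT Qo QD QU A bA.
suff : (@borel R n `&` Q) A by case.
move: A bA; rewrite {1}borel_orthants.
apply: (lambda_system_subset setI_closed_orthants (D := setT)) => //.
  split => //.
  - by split => //; exact: borelT.
  - by move=> A B BA [bA QA] [bB QB]; split; [exact: borelD|exact: QD].
  - move=> A ndA h; split; first by apply: borel_bigcup => m; case: (h m).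
    by apply: QU => // m; case: (h m).
by move=> _ [t _ <-]; split; [exact: borel_orthant|exact: Qo].
Qed.

End BorelOrthants.

(** * The measure of a real distribution function *)

Section DyadicQuantile.
Variables (R : realType) (n : nat) (h : 'rV[R]_n -> R) (C : R) (i0 : 'I_n).
Implicit Types (s t a b q : 'rV[R]_n) (beta : seq bool) (w : R).

Hypothesis h_vol : forall l a b t, uniq l ->
  rat_point a -> rat_point b -> rat_point t -> cw_le a b -> 0 <= Deltas l a b h t.
Hypothesis h_bnd : forall t, rat_point t -> h t <= C.
Hypothesis h_inf : forall i t, rat_point t -> h (update t i (- m%:R)) @[m --> \oo] --> 0.

(* The half-spaces [s_i < r] are enumerated; the list [beta], most recent bit
   first, records on which side of the first ones a point lies, so that its
   cylinder is the box [lo beta <= s < up beta]. *)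
Definition cut (j : nat) : 'I_n * rat := odflt (i0, 0) (unpickle j).

Fixpoint lo beta a := if beta is c :: beta' then
    if c then lo beta' a else
    update (lo beta' a) (cut (size beta')).1
      (Num.max (lo beta' a 0 (cut (size beta')).1) (ratr (cut (size beta')).2))
  else a.

Fixpoint up beta b := if beta is c :: beta' then
    if c then
    update (up beta' b) (cut (size beta')).1
      (Num.min (up beta' b 0 (cut (size beta')).1) (ratr (cut (size beta')).2))
    else up beta' b
  else b.

Lemma rat_point_lo_bits beta a : rat_point a -> rat_point (lo beta a).
Proof.
move=> ra; elim: beta => //= -[//|] beta IH; apply: rat_point_update => //.
by apply: ratr_max; [exact: IH|exists (cut (size beta)).2].
Qed.

Lemma rat_point_up_bits beta b : rat_point b -> rat_point (up beta b).
Proof.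
move=> rb; elim: beta => //= -[|//] beta IH; apply: rat_point_update => //.
by apply: ratr_min; [exact: IH|exists (cut (size beta)).2].
Qed.

Lemma le_lo beta a a' : cw_le a a' -> cw_le (lo beta a) (lo beta a').
Proof.
move=> aa; elim: beta => //= -[//|] beta IH; apply: cw_le_update2 => //.
by rewrite ge_max !le_max IH lexx orbT.
Qed.

Lemma le_up beta b b' : cw_le b b' -> cw_le (up beta b) (up beta b').
Proof.
move=> bb; elim: beta => //= -[|//] beta IH; apply: cw_le_update2 => //.
by rewrite le_min !ge_min IH lexx orbT.
Qed.

Lemma up_min beta b q : up beta (cw_min b q) = cw_min (up beta b) q.
Proof.
elim: beta => //= -[|//] beta ->; apply/rowP => i; rewrite !mxE.
by case: eqVneq => // ->; rewrite minAC.
Qed.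

Definition cylvol beta a b := volume h (lo beta a) (up beta b).

Lemma cylvol_split beta a b :
  cylvol beta a b = cylvol (true :: beta) a b + cylvol (false :: beta) a b.
Proof. exact: volume_split. Qed.

Lemma cylvol_ge0 beta a b : rat_point a -> rat_point b -> 0 <= cylvol beta a b.
Proof.
by move=> ra rb; apply: volume_ge0 => //; [exact: rat_point_lo_bits|exact: rat_point_up_bits].
Qed.

(** * Nested intervals whose lengths are the masses of the boxes *)

Definition mass_seq beta m := cylvol beta (cube_lo R n m) (cube_hi R n m).
Definition mass beta := limn (mass_seq beta).

Lemma mass_seq_nd beta : nondecreasing_seq (mass_seq beta).
Proof.
move=> m p mp; apply: le_volume => //; try exact/rat_point_lo_bits/rat_point_lo;
  try exact/rat_point_up_bits/rat_point_hi.
- by apply: le_lo => i; rewrite !mxE lerN2 ler_nat.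
- by apply: le_up => i; rewrite !mxE ler_nat.
Qed.

Lemma mass_cvg beta : mass_seq beta @ \oo --> mass beta.
Proof.
apply: nondecreasing_is_cvgn; first exact: mass_seq_nd.
exists C => _ [m _ <-]; apply: volume_le_bound => //.
  exact/rat_point_lo_bits/rat_point_lo.
exact/rat_point_up_bits/rat_point_hi.
Qed.

Lemma mass_split beta : mass beta = mass (true :: beta) + mass (false :: beta).
Proof.
apply/(cvg_lim (@Rhausdorff R)).
rewrite (_ : mass_seq beta = mass_seq (true :: beta) \+ mass_seq (false :: beta)).
  by apply: cvgD; exact: mass_cvg.
by apply/funext => m; exact: cylvol_split.
Qed.

Lemma mass_ge0 beta : 0 <= mass beta.
Proof.
apply: limr_ge; first by apply/cvg_ex; exists (mass beta); exact: mass_cvg.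
by near=> m; apply: cylvol_ge0; [exact: rat_point_lo|exact: rat_point_hi].
Unshelve. all: by end_near. Qed.

(** A multidimensional quantile transform: the two halves of a box become adjacent intervals, the
    half with [s_i < r] on the left. *)
Fixpoint left_end beta := if beta is c :: beta' then
    if c then left_end beta' else left_end beta' + mass (true :: beta') else 0.

Definition cell beta : set R := `[left_end beta, left_end beta + mass beta[.

Lemma cell_split beta : cell beta = cell (true :: beta) `|` cell (false :: beta).
Proof.
rewrite /cell [left_end (true :: _)]/= [left_end (false :: _)]/= mass_split addrA.
have := mass_ge0 (true :: beta); have := mass_ge0 (false :: beta).
move=> m1 m2; apply/seteqP; split => w /=; rewrite !in_itv /=.
  by move=> /andP[-> ->]; case: (ltP w _) => _ /=; [left|right].
by move=> [|] /andP[h1 h2]; rewrite ?h1 ?h2 ?andbT //=; lra.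
Qed.

Lemma cell_disj beta : cell (true :: beta) `&` cell (false :: beta) = set0.
Proof.
apply/seteqP; split => w //=; rewrite /cell /= !in_itv /= => -[/andP[_ h1] /andP[h2 _]].
by move: (lt_le_trans h1 h2); rewrite ltxx.
Qed.

Fixpoint node w j := if j is j'.+1 then
    (w < left_end (node w j') + mass (true :: node w j')) :: node w j' else [::].

Lemma size_node w j : size (node w j) = j.
Proof. by elim: j => //= j ->. Qed.

(** The cells of each depth partition the root cell, so a point [w] of it follows exactly one
    path. *)
Lemma cell_node w beta : cell [::] w -> (cell beta w <-> node w (size beta) = beta).
Proof.
move=> w0; elim: beta => [|c beta IH]; first by split.
have sub : cell (c :: beta) w -> cell beta w.
  by rewrite (cell_split beta); case: c => ?; [left|right].
split=> [|/= [cE bE]].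
  move=> cw; have /IH nE := sub cw; rewrite /= nE; congr (_ :: _).
  move: cw; rewrite /cell /=; case: (c); rewrite /= in_itv /=.
    by case/andP.
  by case/andP => + _; rewrite leNgt => /negbTE.
have : cell beta w by exact/IH.
move: cE; rewrite bE (cell_split beta) => cE [|]; rewrite /cell /= in_itv /= => /andP[h1 h2].
  by rewrite -cE h2 /= in_itv /= h1 h2.
by rewrite -cE ltNge h1 /= in_itv /= h1 h2.
Qed.

Definition bit w j := head true (node w j.+1).

Lemma node_inj w w' j j' : (j <= j')%N -> node w j' = node w' j' -> node w j = node w' j.
Proof.
elim: j' => [|j' IH]; first by rewrite leqn0 => /eqP ->.
rewrite leq_eqVlt => /orP[/eqP -> //|]; rewrite ltnS => jj.
by move=> /= [_ /IH]; exact.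
Qed.

Lemma up_bit w j j' b : (j < j')%N -> bit w j -> up (node w j') b 0 (cut j).1 <= ratr (cut j).2.
Proof.
elim: j' => // j' IH; rewrite ltnS leq_eqVlt => /orP[/eqP <-|jj] bw; rewrite /=.
  by move: bw; rewrite /bit /= => ->; rewrite size_node update_eq ge_min lexx orbT.
case: ifP => _; last exact: IH.
rewrite mxE; case: eqVneq => [E|_]; last exact: IH.
by rewrite -E ge_min IH.
Qed.

Lemma lo_bit w j j' a : (j < j')%N -> ~~ bit w j -> ratr (cut j).2 <= lo (node w j') a 0 (cut j).1.
Proof.
elim: j' => // j' IH; rewrite ltnS leq_eqVlt => /orP[/eqP <-|jj] bw; rewrite /=.
  by move: bw; rewrite /bit /= => /negbTE ->; rewrite size_node update_eq le_max lexx orbT.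
case: ifP => _; first exact: IH.
rewrite mxE; case: eqVneq => [E|_]; last exact: IH.
by rewrite -E le_max IH.
Qed.

Lemma mass_node w j : cell [::] w -> 0 < mass (node w j).
Proof.
move=> w0; have /(cell_node _ w0).2 : node w (size (node w j)) = node w j.
  by rewrite size_node.
by rewrite /cell /= in_itv /= => /andP[h1 h2]; rewrite -(ltrD2l (left_end (node w j))) addr0 (le_lt_trans h1).
Qed.

Definition below w (i : 'I_n) (r : rat) := bit w (pickle (i, r)).

Lemma cut_pickle i r : cut (pickle (i, r)) = (i, r).
Proof. by rewrite /cut pickleK. Qed.

(** Contradictory bits would put [w] into a cell whose boxes are inverted in direction [i], hence of
    mass zero, whereas every cell that contains a point has positive mass. The depth [j] is large
    enough to see both bits. *)
Lemma below_mono w i r r' : cell [::] w -> r <= r' -> below w i r -> below w i r'.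
Proof.
move=> w0 rr b1; apply: contraT => b2.
pose j := (maxn (pickle (i, r)) (pickle (i, r'))).+1.
have := mass_node j w0; rewrite (_ : mass _ = 0) ?ltxx //.
apply/(cvg_lim (@Rhausdorff R)); rewrite (_ : mass_seq _ = fun=> 0); first exact: cvg_cst.
apply/funext => m; apply: (@volume0 _ _ _ i).
have h1 := @up_bit w _ j (cube_hi R n m) _ b1; have h2 := @lo_bit w _ j (cube_lo R n m) _ b2.
move: h1 h2; rewrite !cut_pickle /= /j !ltnS leq_maxl leq_maxr.
move=> /(_ isT) h1 /(_ isT) h2; apply: le_trans h1 (le_trans _ h2).
by rewrite ler_rat.
Qed.

Implicit Types v : 'I_n -> rat.

Let mu := @lebesgue_measure R.
Let leb (S : set R) : R := fine (mu S).
Let msbl (S : set R) := measurable (S : set (measurableTypeR R)).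

Let msbl_cell beta : msbl (cell beta).
Proof. exact: measurable_itv. Qed.

Let mu_cell beta : mu (cell beta) = (mass beta)%:E.
Proof.
rewrite /mu /cell lebesgue_measure_itv /= lte_fin ltrDl.
case: ltP => [_|m0]; first by rewrite -EFinD addrAC subrr add0r.
by congr EFin; apply/eqP; rewrite eq_le m0 mass_ge0.
Qed.

Let leb_fin S : S `<=` cell [::] -> msbl S -> mu S \is a fin_num.
Proof.
move=> Sc mS; rewrite ge0_fin_numE ?measure_ge0 //.
apply: (@le_lt_trans _ _ (mu (cell [::]))); first by apply: le_measure => //; apply/mem_set => //; exact: msbl_cell.
by rewrite mu_cell ltry.
Qed.

Let le_leb S S' : S `<=` S' -> S' `<=` cell [::] -> msbl S -> msbl S' -> leb S <= leb S'.
Proof.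
move=> SS Sc mS mS'; apply: fine_le; try exact: leb_fin.
  by apply: leb_fin => //; exact: subset_trans Sc.
by apply: le_measure => //; exact/mem_set.
Qed.

Let leb_ge0 S : 0 <= leb S.
Proof. exact/fine_ge0/measure_ge0. Qed.

Let lebU S S' : S `<=` cell [::] -> S' `<=` cell [::] -> msbl S -> msbl S' ->
  S `&` S' = set0 -> leb (S `|` S') = leb S + leb S'.
Proof.
move=> Sc Sc' mS mS' SS; rewrite /leb /mu measureU // fineD //; exact: leb_fin.
Qed.

Let leb_cell beta : leb (cell beta) = mass beta.
Proof. by rewrite /leb mu_cell. Qed.

Let cell_sub beta : cell beta `<=` cell [::].
Proof.
elim: beta => // c beta IH; apply: subset_trans IH.
by rewrite [X in _ `<=` X]cell_split; case: c => w; [left|right].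
Qed.

Let msbl_below i r : msbl (cell [::] `&` [set w | below w i r]).
Proof.
pose j := pickle (i, r).
rewrite (_ : _ `&` _ = \bigcup_(beta in [set: seq bool])
    (if size beta == j then cell (true :: beta) else set0)).
  apply: (@countable_bigcupT_measurable _ (measurableTypeR R)) => // beta.
  by case: ifP => // _; exact: msbl_cell.
apply/seteqP; split => w.
  move=> [w0 wb]; exists (node w j) => //; rewrite size_node eqxx.
  apply/(cell_node _ w0); rewrite /= size_node; congr (_ :: _).
  by move: wb; rewrite /= /below /bit /=.
move=> [beta _]; case: eqP => // bj wb; have w0 := cell_sub wb.
split => //; have /(cell_node _ w0) := wb.
by rewrite /= bj /below /bit /= -/j => -[-> _].
Qed.

Definition under v := cell [::] `&` [set w | forall i, below w i (v i)].

Let msbl_under v : msbl (under v).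
Proof.
rewrite (_ : under v = cell [::] `&` \bigcap_(i in [set: 'I_n]) (cell [::] `&` [set w | below w i (v i)])).
  apply: measurableI; first exact: msbl_cell.
  apply: fin_bigcap_measurable; first exact: finite_finset.
  by move=> i _; exact: msbl_below.
apply/seteqP; split => [w [w0 wb]|w [w0 wb]]; split => // i; first by move=> _; split; [|exact: wb].
by case: (wb i I).
Qed.

Definition ratv v : 'rV[R]_n := \row_i ratr (v i).

Lemma rat_point_ratv v : rat_point (ratv v).
Proof. by move=> i; exists (v i); rewrite mxE. Qed.

(** At depth [J] all half-spaces that define [under v] have been consulted, so a cell lies inside
    [under v] or misses it: clipping at [ratv v] changes nothing or leaves an empty box. At smaller
    depths both sides are additive over the two halves of a cell. *)
Lemma cylvol_cvg_leb v beta J : (forall i, (pickle (i, v i) < J)%N) -> (size beta <= J)%N ->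
  cylvol beta (cube_lo R n m) (cw_min (cube_hi R n m) (ratv v)) @[m --> \oo] -->
  leb (cell beta `&` under v).
Proof.
move=> vJ; move: {2}(J - size beta)%N (erefl (J - size beta)%N) => d.
have rm m : rat_point (cw_min (cube_hi R n m) (ratv v)).
  by apply: rat_point_min; [exact: rat_point_hi|exact: rat_point_ratv].
have mcu be : msbl (cell be `&` under v) by apply: measurableI; [exact: msbl_cell|exact: msbl_under].
have csub be : cell be `&` under v `<=` cell [::].
  by apply: subset_trans (@cell_sub be); exact: subIsetl.
elim: d beta => [|d IH] beta dE sJ.
  have {dE sJ} sJ : size beta = J by apply/eqP; rewrite eqn_leq sJ -subn_eq0 dE.
  (* An empty cell has no point from which bits could be read; its mass is zero, which squeezes the
     volumes. *)
  have [[w wb]|nw] := pselect (exists w, cell beta w); last first.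
    have c0 : cell beta = set0 by apply/seteqP; split => // w wb; case: nw; exists w.
    rewrite c0 set0I -c0 leb_cell.
    apply: (@squeeze_cvgr _ _ _ _ (fun=> 0) (mass_seq beta)); last exact: mass_cvg.
      apply: nearW => m; apply/andP; split.
        by apply: cylvol_ge0 => //; exact: rat_point_lo.
      apply: le_volume => //; try exact/rat_point_lo_bits/rat_point_lo;
        try exact/rat_point_up_bits/rat_point_hi; try exact/rat_point_up_bits.
      exact/le_up/cw_minll.
    by rewrite -leb_cell c0 /leb /mu measure0; exact: cvg_cst.
  have w0 := cell_sub wb.
  have nwJ : node w J = beta by have /(cell_node _ w0) := wb; rewrite sJ.
  have [/forallP wv|] := boolP [forall i, below w i (v i)].
    have -> : cell beta `&` under v = cell beta.
      apply/setIidl => w' wb'; have w0' := cell_sub wb'; split => // i.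
      rewrite /below /bit (@node_inj w' w _ J) //; first exact: wv.
      by rewrite nwJ; have /(cell_node _ w0') := wb'; rewrite sJ.
    rewrite leb_cell; apply: cvg_trans (@mass_cvg beta).
    apply: near_eq_cvg; apply: nearW => m; rewrite /mass_seq /cylvol up_min cw_min_l //.
    move=> i; rewrite mxE; have := @up_bit w _ J (cube_hi R n m) (vJ i) (wv i).
    by rewrite cut_pickle nwJ.
  rewrite negb_forall => /existsP[i wi].
  have -> : cell beta `&` under v = set0.
    apply/seteqP; split => // w' [wb' [w0' /(_ i)]]; move: wi.
    rewrite /below /bit (@node_inj w' w _ J) // => [/negP//|].
    by rewrite nwJ; have /(cell_node _ w0') := wb'; rewrite sJ.
  rewrite /leb /mu measure0 [fine _]/=.
  rewrite (_ : (fun m => _) = fun=> 0); first exact: cvg_cst.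
  apply/funext => m; rewrite /cylvol up_min; apply: (@volume0 _ _ _ i).
  apply: (@le_trans _ _ (ratr (v i))); first by rewrite mxE [X in Num.min _ X]mxE ge_min lexx orbT.
  have := @lo_bit w _ J (cube_lo R n m) (vJ i) wi.
  by rewrite cut_pickle nwJ.
rewrite cell_split setIUl lebU; [|exact: csub|exact: csub|exact: mcu|exact: mcu|
  by rewrite setIACA cell_disj set0I].
under eq_fun do rewrite cylvol_split.
by apply: cvgD; apply: IH => /=; lia.
Qed.

Lemma leb_under v : leb (under v) = h (ratv v).
Proof.
pose J := (\max_i pickle (i, v i)).+1.
have vJ i : (pickle (i, v i) < J)%N.
  by rewrite ltnS; exact: (@leq_bigmax _ (fun i => pickle (i, v i))).
have := @cylvol_cvg_leb v [::] J vJ isT.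
rewrite setIA setIid => c1.
exact: (cvg_unique (@Rhausdorff R) c1 (volume_cvg h_vol h_inf (rat_point_ratv v))).
Qed.

(** * The quantile map and the image of Lebesgue measure *)

Definition Omega := cell [::] `&` [set w | forall i,
  (exists r, below w i r) /\ (exists r, ~~ below w i r)].

(** On [Omega] the set is nonempty and bounded below, so every coordinate is a genuine infimum. *)
Definition pt w : 'rV[R]_n := \row_i inf (ratr @` [set r | below w i r]).

(** [below w i r] alone bounds the coordinate by [ratr r] only weakly, hence the rational strictly
    under [c]. *)
Lemma lt_pt w i c : Omega w -> (pt w 0 i < c <-> exists2 r, below w i r & ratr r < c).
Proof.
move=> [w0 /(_ i) [[r0 b0] [r1 b1]]]; rewrite mxE.
have lb : has_lbound ((ratr : rat -> R) @` [set r | below w i r]).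
  exists (ratr r1) => _ [r br <-]; rewrite ler_rat leNgt; apply/negP => rr.
  by move/negP: b1; apply; apply: below_mono (ltW rr) br.
split=> [/inf_lt[|_ [r br <-]]|[r br rc]].
- by exists (ratr r0), r0.
- by exists r.
by apply: le_lt_trans rc; apply: ge_inf => //; exists r.
Qed.

Let Omega_sub : Omega `<=` cell [::].
Proof. by move=> w []. Qed.

Let msbl_Omega : msbl Omega.
Proof.
rewrite (_ : Omega = cell [::] `&` \bigcap_(i in [set: 'I_n])
   ((\bigcup_r (cell [::] `&` [set w | below w i r])) `&`
    (\bigcup_r (cell [::] `\` (cell [::] `&` [set w | below w i r]))))).
  apply: measurableI; first exact: msbl_cell.
  apply: fin_bigcap_measurable; first exact: finite_finset.
  move=> i _; apply: measurableI; apply: (@countable_bigcupT_measurable _ (measurableTypeR R)) => // r.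
    exact: msbl_below.
  by apply: measurableD; [exact: msbl_cell|exact: msbl_below].
apply/seteqP; split => w [w0 wi]; split => // i.
  have [[r br] [r' br']] := wi i.
  split; first by exists r.
  by exists r' => //; split => // -[_ ]; exact/negP.
have [[r _ [_ br]] [r' _ [_ br']]] := wi i I; split; first by exists r.
by exists r'; apply/negP => b; apply: br'.
Qed.

Lemma msbl_pt A : borel A -> msbl (Omega `&` pt @^-1` A).
Proof.
apply: (@borel_ind _ _ [set A | msbl (Omega `&` pt @^-1` A)]) => {A} /=.
- by rewrite preimage_setT setIT; exact: msbl_Omega.
- move=> t.
  rewrite (_ : _ `&` _ = Omega `&` \bigcap_(i in [set: 'I_n])
    \bigcup_(r in [set r : rat | ratr r < t 0 i]) (cell [::] `&` [set w | below w i r])).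
    apply: measurableI; first exact: msbl_Omega.
    apply: fin_bigcap_measurable; first exact: finite_finset.
    move=> i _; rewrite bigcup_mkcond.
    apply: (@countable_bigcupT_measurable _ (measurableTypeR R)) => // r.
    by case: ifP => // _; exact: msbl_below.
  apply/seteqP; split => w [wO wt]; split => // i.
    move=> _; have /(lt_pt _ _ wO)[r br rt] := wt i.
    by exists r => //; split => //; exact: Omega_sub.
  by apply/(lt_pt _ _ wO); have [r rt [_ br]] := wt i I; exists r.
- move=> A B BA _ _ mA mB; rewrite (_ : _ `&` _ = (Omega `&` pt @^-1` A) `\` (Omega `&` pt @^-1` B)).
    exact: measurableD.
  apply/seteqP; split => w; rewrite /preimage /setI /setD /=; first by tauto.
  by tauto.
- move=> A _ _ mA; rewrite preimage_bigcup setI_bigcupr.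
  exact: bigcupT_measurable.
Qed.

Definition rho (A : set 'rV[R]_n) : R := leb (Omega `&` pt @^-1` A).

Let preOmega_sub A : Omega `&` pt @^-1` A `<=` cell [::].
Proof. by move=> w [[]]. Qed.

Lemma rhoU A B : borel A -> borel B -> A `&` B = set0 -> rho (A `|` B) = rho A + rho B.
Proof.
move=> bA bB AB; rewrite /rho preimage_setU setIUr lebU;
  [by []|exact: preOmega_sub|exact: preOmega_sub|exact: msbl_pt|exact: msbl_pt|].
by rewrite setIACA setIid -preimage_setI AB preimage_set0 setI0.
Qed.

Lemma rho_ge0 A : 0 <= rho A.
Proof. exact: leb_ge0. Qed.

Let leb_cvg (S : nat -> set R) : (forall m, msbl (S m)) -> nondecreasing_seq S ->
  (forall m, S m `<=` cell [::]) -> leb (S m) @[m --> \oo] --> leb (\bigcup_m S m).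
Proof.
move=> mS ndS Sc.
have mU : msbl (\bigcup_m S m) by exact: bigcupT_measurable.
have Uc : \bigcup_m S m `<=` cell [::] by move=> w [m _ /Sc].
apply: fine_cvg; rewrite fineK; last exact: leb_fin.
exact: nondecreasing_cvg_mu.
Qed.

Lemma rho_cvg (A : nat -> set 'rV[R]_n) : (forall m, borel (A m)) ->
  (forall m, A m `<=` A m.+1) -> rho (A m) @[m --> \oo] --> rho (\bigcup_m A m).
Proof.
move=> bA ndA; rewrite /rho preimage_bigcup setI_bigcupr.
apply: leb_cvg => [m||m]; [exact: msbl_pt| |exact: preOmega_sub].
by apply/nondecreasing_seqP => m; apply/subsetPset; apply: setIS => w /ndA.
Qed.

(** A point of [under v] outside [Omega] has a coordinate at minus infinity, so it lies in some
    [S i], whose measure is bounded by the values of [h] as coordinate [i] tends to minus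
    infinity. *)
Let leb_under_Omega v : leb (Omega `&` under v) = h (ratv v).
Proof.
pose S i := \bigcap_m under (fun j => if j == i then - m%:R else v j).
have mS i : msbl (S i) by apply: bigcapT_measurable => m; exact: msbl_under.
have S_sub i : S i `<=` cell [::] by move=> w /(_ 0%N I) [].
have S0 i : mu (S i) = 0%E.
  rewrite -(fineK (leb_fin (S_sub i) (mS i))) -/(leb (S i)); congr EFin.
  apply/eqP; rewrite eq_le leb_ge0 andbT.
  apply: (cvgr_to_ge (h_inf i (rat_point_ratv v))); apply: nearW => m.
  have -> : update (ratv v) i (- m%:R) = ratv (fun j => if j == i then - m%:R else v j).
    by apply/rowP => j; rewrite !mxE; case: eqP => // _; rewrite rmorphN /= ratr_nat.
  rewrite -leb_under; apply: le_leb => //.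
    by move=> w /(_ m I).
  by move=> w [].
have mUO : msbl (Omega `&` under v) by apply: measurableI; [exact: msbl_Omega|exact: msbl_under].
have mUD : msbl (under v `\` Omega) by apply: measurableD; [exact: msbl_under|exact: msbl_Omega].
rewrite -leb_under -[in RHS](setUIDK (under v) Omega) setIC lebU //; first last.
- by apply/seteqP; split => w // [[_ +] [_]].
- by rewrite setIC.
- by move=> w [[]].
- by move=> w [_ []].
rewrite setIC -[LHS]addr0; congr (_ + _); rewrite /leb (_ : mu _ = 0%E) //.
apply: measure_negligible => //.
(* The finite union over coordinates is indexed by natural numbers and padded with empty sets. *)
have : (@lebesgue_measure R).-negligible (\bigcup_k (if insub k is Some i then S i else set0)); last first.
  apply: negligibleS.
  move=> w [[w0 wv] nO].
  have [i ni] : exists i, ~ exists r, ~~ below w i r.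
    apply: contrapT => hn; apply: nO; split => // i; split; first by exists (v i); exact: wv.
    by apply: contrapT => hi; apply: hn; exists i.
  exists i => //; rewrite valK => m _; split => // j /=; case: eqVneq => [->|_]; last exact: wv.
  by apply/negPn/negP => hb; apply: ni; exists (- m%:R).
apply: negligible_bigcup => k; case: insub => [i|]; last exact: negligible_set0.
by apply/negligibleP; [exact: mS|exact: S0].
Qed.

(** A point lies in the orthant of [t] when each coordinate is undercut by a rational strictly below
    that of [t]; the measure is therefore a limit of [h] from strictly below. *)
Lemma rho_orthant (v : nat -> 'I_n -> rat) t : (forall m, cw_le (ratv (v m)) (ratv (v m.+1))) ->
  (forall m, cw_lt (ratv (v m)) t) ->
  (forall s, cw_lt s t -> exists m, cw_lt s (ratv (v m))) ->
  h (ratv (v m)) @[m --> \oo] --> rho (orthant t).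
Proof.
move=> vnd vt vcof.
rewrite /rho (_ : _ `&` _ = \bigcup_m (Omega `&` under (v m))).
  under eq_fun do rewrite -leb_under_Omega.
  apply: leb_cvg => [m||m].
  - by apply: measurableI; [exact: msbl_Omega|exact: msbl_under].
  - apply/nondecreasing_seqP => m; apply/subsetPset; apply: setIS => w [w0 wb].
    split => // i; apply: below_mono (wb i) => //.
    by have := vnd m i; rewrite !mxE ler_rat.
  - by move=> w [[]].
apply/seteqP; split => w.
  move=> [wO wt].
  have hr i : exists r, below w i r /\ ratr r < t 0 i.
    by have /(lt_pt _ _ wO)[r] := wt i; exists r.
  have [|m hm] := vcof (\row_i ratr (sval (cid (hr i)))).
    by move=> i; rewrite mxE; case: (cid (hr i)) => r [].
  exists m => //; split => //; split; first exact: Omega_sub.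
  move=> i; have := hm i; rewrite !mxE ltr_rat; case: (cid (hr i)) => r [br _] /= /ltW rv.
  by apply: below_mono br => //; exact: Omega_sub.
move=> [m _ [wO [w0 wb]]]; split => // i; apply/(lt_pt _ _ wO).
by exists (v m i); [exact: wb|have := vt m i; rewrite mxE].
Qed.

End DyadicQuantile.

Lemma ratr_approx (R : realType) (c : R) : exists v : nat -> rat,
  [/\ forall m, v m <= v m.+1, forall m, ratr (v m) < c &
      forall x, x < c -> exists m, x < ratr (v m)].
Proof.
have step (y : R) : {r : rat | y < c -> y < ratr r < c}.
  have [yc|cy] := ltP y c; last by exists 0.
  by apply: cid; have [r] := rat_in_itvoo yc; rewrite in_itv; exists r.
(* Each term after the first lies strictly between [c] and the maximum of [c - m%:R^-1] and its
   predecessor; the default [0] in [step] is never reached. *)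
pose v := fix v m : rat := sval (step
  (if m is p.+1 then Num.max (c - m%:R^-1) (ratr (v p)) else c - 1)).
have inv m : c - m.+1%:R^-1 < c by rewrite gtrBl invr_gt0 ltr0n.
have vc m : ratr (v m) < c.
  elim: m => [|m IH] /=; case: (step _) => r /= hr.
    by have /hr/andP[] : c - 1 < c by rewrite gtrBl.
  by have /hr/andP[] : Num.max (c - m.+1%:R^-1) (ratr (v m)) < c by rewrite gt_max inv.
have vS m : c - m.+1%:R^-1 < ratr (v m.+1) /\ ratr (v m) < ratr (v m.+1) :> R.
  rewrite [v m.+1]/=; case: (step _) => r /= hr.
  have /hr/andP[] : Num.max (c - m.+1%:R^-1) (ratr (v m)) < c by rewrite gt_max inv vc.
  by rewrite gt_max => /andP[].
exists v; split => // [m|x xc].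
  by rewrite -(ler_rat R) ltW //; case: (vS m).
have [p hp] := ltr_add_invr xc; exists p.+1.
by apply: (@lt_trans _ _ (c - p.+1%:R^-1)); [rewrite ltrBrDr|case: (vS p)].
Qed.

Lemma nondecreasing_orthant_cube (R : realType) (n : nat) :
  nondecreasing_seq (fun m => orthant (cube_hi R n m)).
Proof.
move=> m p mp; apply/subsetPset => s hs; apply: (cw_lt_le_trans hs) => i.
by rewrite !mxE ler_nat.
Qed.

Lemma bigcup_orthant_cube (R : realType) (n : nat) :
  \bigcup_m orthant (cube_hi R n m) = setT.
Proof.
apply/seteqP; split => // s _.
pose m := \max_(i < n) (Num.truncn (s ord0 i)).+1; exists m => // i; rewrite mxE.
apply: (lt_le_trans (truncnS_gt (s 0 i))); rewrite ler_nat.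
exact: (@leq_bigmax _ (fun j : 'I_n => (Num.truncn (s ord0 j)).+1) i).
Qed.

(** * Group-valued measures *)

Section GroupValuedMeasure.
Variables (R : realType) (n : nat) (G : porderZmodType).
Hypothesis G_po : po_group_law G.
Hypothesis G_dir : directed G.
Hypothesis G_msc : monotone_sigma_complete G.
Hypothesis G_arch : archimedean G.
Variables (i0 : 'I_n) (H : 'rV[R]_n -> G) (u : G).
Implicit Types (s t a b : 'rV[R]_n) (A B : set 'rV[R]_n) (g : G) (P : set G).

Hypothesis H_vol : forall l a b t, uniq l -> cw_le a b -> 0 <= Deltas l a b H t.
Hypothesis H_le : forall t, H t <= u.
Hypothesis H_inf : forall i t,
  infimums (range (fun m : nat => H (update t i (- m%:R)))) 0.
Hypothesis H_sup : forall t, supremums (H @` orthant t) (H t).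

Let H_ge0 t : 0 <= H t.
Proof. exact: (@H_vol [::] t t t isT (cw_le_refl t)). Qed.

Let u_ge0 : 0 <= u.
Proof. exact: le_trans (H_ge0 0) (H_le 0). Qed.

Let le_H s t : cw_le s t -> H s <= H t.
Proof.
move=> st; suff K l : H s <= H (override l s t).
  by have := K (enum 'I_n); rewrite override_enum.
elim: l => [|i l IH]; first by rewrite override_nil.
apply: (le_trans IH); rewrite override_cons.
have := @H_vol [:: i] (override l s t) (update (override l s t) i (t 0 i)) (override l s t).
rewrite /= /Delta update_eq update_id po_subr_ge0 //; apply => //.
by move=> j; rewrite !mxE; case: eqVneq => [->|]; case: ifP.
Qed.

Let Deltas_le_u l a b t : uniq l -> cw_le a b -> Deltas l a b H t <= u.
Proof.
move=> + ab; elim: l t => [|i l IH] t; first by move=> _; exact: H_le.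
move=> /andP[il ul]; rewrite Deltas_cons; apply: le_trans (IH (update t i (b 0 i)) ul).
by rewrite po_lerBlDr //; apply: po_ler_wnDr => //; exact: H_vol.
Qed.

Let st P g : R := state R u P g.
Let h P : 'rV[R]_n -> R := fun t => st P (H t).

Let ubd g : 0 <= g -> g <= u -> ubounded u g.
Proof. exact: ubounded_itv. Qed.

Let ubH t : ubounded u (H t).
Proof. by apply: ubd; [exact: H_ge0|exact: H_le]. Qed.

Lemma generic_Deltas l a b t : uniq l -> cw_le a b ->
  generically (fun P => P u -> Deltas l a b (h P) t = st P (Deltas l a b H t)).
Proof.
move=> + ab; elim: l t => [|i l IH] t; first by move=> _; exact: generically_true.
move=> /andP[il ul].
have bD s : ubounded u (Deltas l a b H s) by apply: ubd; [exact: H_vol|exact: Deltas_le_u].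
have g1 := IH (update t i (b 0 i)) ul; have g2 := IH (update t i (a 0 i)) ul.
have g3 := generic_stateB R G_po G_dir G_arch u_ge0 (bD (update t i (b 0 i))) (bD (update t i (a 0 i))).
apply: generically_sub (generically_and (generically_and g1 g2) g3) _.
by move=> P fP [[h1 h2] h3] Pu; rewrite !Deltas_cons h1 // h2 // /st h3.
Qed.

Lemma rat_point_ffun t : rat_point t -> exists v : {ffun 'I_n -> rat}, t = ratv R v.
Proof.
move=> rt; exists [ffun i => sval (cid (rt i))]; apply/rowP => i.
by rewrite mxE ffunE; case: (cid (rt i)).
Qed.

Lemma generic_vol : generically (fun P => P u -> forall l a b t, uniq l ->
  rat_point a -> rat_point b -> rat_point t -> cw_le a b -> 0 <= Deltas l a b (h P) t).
Proof.
pose I := (seq 'I_n * {ffun 'I_n -> rat} * {ffun 'I_n -> rat} * {ffun 'I_n -> rat})%type.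
have g : generically (fun P => forall x : I, let: (l, a, b, t) := x in
    P u -> uniq l -> cw_le (ratv R a) (ratv R b) ->
    0 <= Deltas l (ratv R a) (ratv R b) (h P) (ratv R t)).
  apply: generically_all => -[[[l a] b] t].
  have [[ul ab]|no] := pselect (uniq l /\ cw_le (ratv R a) (ratv R b)); last first.
    by apply: generically_true => P _ _ ul ab; case: no.
  apply: generically_sub (generic_Deltas (ratv R t) ul ab) _ => P fP hP Pu _ _.
  rewrite hP //; apply: state_ge0 => //; last exact: H_vol.
  by apply: ubd; [exact: H_vol|exact: Deltas_le_u].
apply: generically_sub g _ => P fP hP Pu l a b t ul.
move=> /rat_point_ffun[a' ->] /rat_point_ffun[b' ->] /rat_point_ffun[t' ->].
exact: (hP (l, a', b', t')).
Qed.

(** The functionals are known to preserve suprema, so the infimum is turned into the supremum [u] of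
    the increasing sequence [u - z m]. *)
Lemma generic_inf : generically (fun P => P u -> forall i t, rat_point t ->
  h P (update t i (- m%:R)) @[m --> \oo] --> 0).
Proof.
have g : generically (fun P => forall x : 'I_n * {ffun 'I_n -> rat},
    let: (i, t) := x in P u -> h P (update (ratv R t) i (- m%:R)) @[m --> \oo] --> 0).
  apply: generically_all => -[i v]; pose t := ratv R v.
  pose z m := H (update t i (- m%:R)).
  have bz m : ubounded u (u - z m).
    apply: ubd; first by rewrite po_subr_ge0 //; exact: H_le.
    by rewrite po_lerBlDr //; apply: po_ler_wnDr => //; exact: H_ge0.
  have bu : ubounded u u by exact: ubd.
  have nz : nondecreasing_seq (fun m => u - z m).
    move=> m p mp; rewrite po_lerD2l // po_lerN2 //; apply/le_H/cw_le_update.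
    by rewrite lerN2 ler_nat.
  have supz : supremums (range (fun m => u - z m)) u.
    have := supremumsD G_po u (supremumsN G_po (H_inf i t)).
    by rewrite oppr0 add0r; under eq_fun do rewrite addrC.
  have g1 := generic_state_cvg R G_po u_ge0 nz bz bu supz.
  have g2 : generically (fun P => forall m : nat, P u -> st P (u - z m) = st P u - st P (z m)).
    apply: generically_all => m.
    exact: (generic_stateB R G_po G_dir G_arch u_ge0 bu (ubH (update t i (- m%:R)))).
  apply: generically_sub (generically_and g1 g2) _ => P fP [h1 h2] Pu.
  rewrite (_ : (fun m => _) = fun m => st P u - st P (u - z m)).
    by rewrite -[X in _ --> X](subrr (st P u)); apply: cvgB; [exact: cvg_cst|exact: h1].
  by apply/funext => m; rewrite h2 // opprB addrCA subrr addr0.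
apply: generically_sub g _ => P fP hP Pu i t /rat_point_ffun[v ->].
exact: (hP (i, v)).
Qed.

Let h_bnd P : is_filter P -> P u -> forall t, rat_point t -> h P t <= st P u.
Proof. by move=> fP Pu t _; apply: le_state => //; exact: ubd. Qed.

Definition measure_value A g := [/\ borel A, 0 <= g, g <= u &
  generically (fun P => P u -> st P g = rho (h P) i0 A)].

(** State and measure are limits along one rational sequence increasing to [t]: [H_sup] makes [H t]
    the supremum of [H] along it, and [rho_orthant] computes the measure. *)
Lemma measure_value_orthant t : measure_value (orthant t) (H t).
Proof.
split => //; first exact: borel_orthant.
have [v vP] := @choice _ _ (fun i (v : nat -> rat) => [/\ forall m, v m <= v m.+1,
  forall m, ratr (v m) < t 0 i & forall x, x < t 0 i -> exists m, x < ratr (v m)])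
  (fun i => ratr_approx (t 0 i)).
pose V m i := v i m.
have Vnd m : cw_le (ratv R (V m)) (ratv R (V m.+1)).
  by move=> i; rewrite !mxE ler_rat /V; case: (vP i).
have Vnd2 m p : (m <= p)%N -> cw_le (ratv R (V m)) (ratv R (V p)).
  move=> /subnKC <-; elim: (p - m)%N => [|d IH]; first by rewrite addn0.
  by rewrite addnS; exact: cw_le_trans (Vnd _).
have Vt m : cw_lt (ratv R (V m)) t.
  by move=> i; rewrite mxE /V; case: (vP i).
have Vcof s : cw_lt s t -> exists m, cw_lt s (ratv R (V m)).
  move=> hs; have hm i : exists m, s 0 i < ratr (v i m) by case: (vP i) => _ _; apply.
  have [w wP] := choice hm; exists (\max_i w i) => i.
  apply: (@lt_le_trans _ _ (ratv R (V (w i)) 0 i)); first by rewrite mxE; exact: wP.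
  by apply: Vnd2; exact: (@leq_bigmax _ w).
have ndH : nondecreasing_seq (fun m => H (ratv R (V m))).
  by move=> m p /Vnd2 /le_H.
have supH : supremums (range (fun m => H (ratv R (V m)))) (H t).
  split; first by move=> _ [m _ <-]; exact/le_H/cw_lt_le.
  move=> y yub; have [_] := H_sup t; apply => _ [s /Vcof[m sm] <-].
  by apply: (@le_trans _ _ (H (ratv R (V m)))); [exact/le_H/cw_lt_le|apply: yub; exists m].
have g := generic_state_cvg R G_po u_ge0 ndH (fun m => ubH _) (ubH t) supH.
apply: generically_sub (generically_and g (generically_and generic_vol generic_inf)) _.
move=> P fP [h1 [h2 h3]] Pu.
apply: (cvg_unique (@Rhausdorff R) (h1 Pu)).
exact: (rho_orthant (h2 Pu) (h_bnd fP Pu) (h3 Pu)).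
Qed.

(** Otherwise [g - g'] is a condition, and a generic filter through it gives it a positive state,
    although the measure of [A] does not exceed that of [B]. *)
Lemma measure_value_le A B g g' : A `<=` B -> measure_value A g -> measure_value B g' ->
  g <= g'.
Proof.
move=> AB [bA g0 gu gA] [bB g0' gu' gB]; rewrite -po_subr_ge0 // -po_lerN2 // oppr0 opprB.
apply/negPn/negP => cgg.
have bgg : ubounded u (g - g') by apply: uboundedD => //; [|apply: uboundedN => //]; exact: ubd.
have g1 := generic_stateB R G_po G_dir G_arch u_ge0 (ubd g0 gu) (ubd g0' gu').
have g2 := generic_state_gt0 R G_po G_dir G_arch u_ge0 bgg.
have [P [fP Pg [[[hA hB] [h1 h2]] hv]]] := generically_ex (generically_and
  (generically_and (generically_and gA gB) (generically_and g1 g2)) generic_vol) cgg.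
(* The normalisation comes for free from [g - g' <= u]. *)
have Pu : P u.
  apply: filter_up fP _ _ Pg _; apply: le_trans gu.
  by rewrite po_lerBlDr // po_ler_wnDr.
have := h2 Pu Pg; rewrite h1 // -/(st P g) -/(st P g') hA // hB // subr_gt0.
rewrite -(setUIDK B A) setIidr // (rhoU i0 (hv Pu) (h_bnd fP Pu)) //.
- by rewrite gtrDl ltNge rho_ge0.
- exact: borelD.
- by apply/seteqP; split => x // [] Ax [].
Qed.

Lemma measure_value_uniq A g g' : measure_value A g -> measure_value A g' -> g = g'.
Proof. by move=> h1 h2; apply/eqP; rewrite eq_le !(measure_value_le (A := A) (B := A)). Qed.

Lemma measure_valueD A B g g' : B `<=` A -> measure_value A g -> measure_value B g' ->
  measure_value (A `\` B) (g - g').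
Proof.
move=> BA hA hB; have gg := measure_value_le BA hB hA.
case: hA hB => [bA g0 gu gA] [bB g0' gu' gB]; split.
- exact: borelD.
- by rewrite po_subr_ge0.
- by apply: le_trans gu; rewrite po_lerBlDr // po_ler_wnDr.
have g1 := generic_stateB R G_po G_dir G_arch u_ge0 (ubd g0 gu) (ubd g0' gu').
apply: generically_sub (generically_and (generically_and gA gB)
  (generically_and g1 generic_vol)) _.
move=> P fP [[hA hB] [h1 hv]] Pu; rewrite /st h1 // -/(st P g) -/(st P g') hA // hB //.
rewrite -{1}(setUIDK A B) setIidr // (rhoU i0 (hv Pu) (h_bnd fP Pu)) //.
- by rewrite addrAC subrr add0r.
- exact: borelD.
- by apply/seteqP; split => x // [] Ax [].
Qed.

(** The values increase with the sets, so their supremum exists in [G]; a further countable family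
    of dense sets makes the functionals preserve it. *)
Lemma measure_value_bigcup (A : nat -> set 'rV[R]_n) (g : nat -> G) :
  nondecreasing_seq A -> (forall m, measure_value (A m) (g m)) ->
  exists2 s, supremums (range g) s & measure_value (\bigcup_m A m) s.
Proof.
move=> ndA hA.
have ndg : nondecreasing_seq g.
  by move=> m p mp; apply: measure_value_le (hA m) (hA p); exact/subsetPset/ndA.
have gub : ubound (range g) u by move=> _ [m _ <-]; case: (hA m).
have [s sups] := G_msc ndg (ex_intro _ u gub).
have s0 : 0 <= s.
  apply: (@le_trans _ _ (g 0%N)); first by case: (hA 0%N).
  by case: sups => + _; apply; exists 0%N.
have su : s <= u by case: sups => _; apply.
exists s => //; split => //; first by apply: borel_bigcup => m; case: (hA m).
have bg m : ubounded u (g m) by case: (hA m) => _ g0 gu _; exact: ubd.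
have g1 := generic_state_cvg R G_po u_ge0 ndg bg (ubd s0 su) sups.
have g2 : generically (fun P => forall m : nat, P u -> st P (g m) = rho (h P) i0 (A m)).
  by apply: generically_all => m; case: (hA m).
apply: generically_sub (generically_and (generically_and g1 g2) generic_vol) _.
move=> P fP [[h1 h2] hv] Pu; apply: (cvg_unique (@Rhausdorff R) (h1 Pu)).
rewrite (_ : (fun m => _) = (fun m => rho (h P) i0 (A m))).
  apply: (rho_cvg (hv Pu) (h_bnd fP Pu)) => m; first by case: (hA m).
  by apply/subsetPset/ndA.
by apply/funext => m; exact: h2.
Qed.

Lemma measure_valueT : exists g, measure_value setT g.
Proof.
have [g _] := measure_value_bigcup (@nondecreasing_orthant_cube R n)
  (fun m => measure_value_orthant (cube_hi R n m)).
by rewrite bigcup_orthant_cube; exists g.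
Qed.

Lemma measure_value_ex A : borel A -> exists g, measure_value A g.
Proof.
apply: (@borel_ind _ _ [set A | exists g, measure_value A g]) => {A} /=.
- exact: measure_valueT.
- by move=> t; exists (H t); exact: measure_value_orthant.
- by move=> A B BA _ _ [g hg] [g' hg']; exists (g - g'); exact: measure_valueD.
- move=> A ndA _ /choice[g hg].
  by have [s _ hs] := measure_value_bigcup ndA hg; exists s.
Qed.

Lemma group_valued_measure : exists mu : set 'rV[R]_n -> G,
  [/\ forall t, mu (orthant t) = H t,
      forall A, borel A -> 0 <= mu A,
      forall A B, borel A -> borel B -> A `&` B = set0 -> mu (A `|` B) = mu A + mu B &
      forall A : nat -> set 'rV[R]_n, (forall m, borel (A m)) -> nondecreasing_seq A ->
        supremums (range (mu \o A)) (mu (\bigcup_m A m))].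
Proof.
pose mu A := xget 0 [set g | measure_value A g].
have muP A : borel A -> measure_value A (mu A).
  by move=> /measure_value_ex[g hg]; exact: (@xgetI _ 0 [set g | measure_value A g] g).
exists mu; split.
- by move=> t; exact: (measure_value_uniq (muP _ (borel_orthant t)) (measure_value_orthant t)).
- by move=> A /muP[].
- move=> A B bA bB AB; have hU := muP _ (borelU bA bB).
  have := measure_valueD (@subsetUl _ A B) hU (muP _ bA).
  rewrite (_ : (A `|` B) `\` A = B).
    by move=> /(measure_value_uniq (muP _ bB)) ->; rewrite addrC subrK.
  apply/seteqP; split => x; first by move=> [[]].
  by move=> Bx; split; [right|move=> Ax; have [] : set0 x by rewrite -AB].
- move=> A bA ndA; have [s sups hs] := measure_value_bigcup ndA (fun m => muP _ (bA m)).
  by rewrite (measure_value_uniq (muP _ (borel_bigcup bA)) hs).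
Qed.

End GroupValuedMeasure.

(** * Characteristic points *)

Section Levels.
Variables (R : realType) (n k : nat) (G : porderZmodType).
Hypothesis k_ge1 : (1 <= k)%N.
Hypothesis G_po : po_group_law G.
Hypothesis G_dir : directed G.
Variable F : 'rV[R]_n -> Gamma_ea G k.
Hypothesis F_sr : is_spectral_resolution F.
Hypothesis F_ord : ordering_property F.
Implicit Types (r s t : 'rV[R]_n) (g : G).

Definition lev t : nat := `|(val (F t)).1|%N.
Definition gpart t : G := (val (F t)).2.

Lemma gea_leE (a b : Gamma_ea G k) : (a <= b) =
  ((val a).1 < (val b).1) || ((val a).1 == (val b).1) && ((val a).2 <= (val b).2).
Proof. by rewrite -Zlex_leE. Qed.

Lemma gea_ge0 (a : Gamma_ea G k) :
  (0 < (val a).1) || ((val a).1 == 0) && (0 <= (val a).2).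
Proof.
by have /andP[+ _] := valP a; rewrite Zlex_leE /= [0 == _]eq_sym.
Qed.

Lemma gea_le1 (a : Gamma_ea G k) :
  ((val a).1 < k%:Z) || ((val a).1 == k%:Z) && ((val a).2 <= 0).
Proof. by have /andP[_] := valP a; rewrite Zlex_leE. Qed.

Lemma gea_ex (m : nat) g : (0 < m)%N || (m == 0)%N && (0 <= g) ->
  (m < k)%N || (m == k) && (g <= 0) ->
  exists a : Gamma_ea G k, val a = (m%:Z, g).
Proof.
move=> h0 h1.
have h : 0 <= ((m%:Z, g) : Zlex G) <= Zlex_unit G k.
  rewrite !Zlex_leE /= ltz_nat eqz_nat h1 andbT.
  by rewrite -[0]/(0%N%:Z) ltz_nat eqz_nat eq_sym.
by exists (exist _ ((m%:Z, g) : Zlex G) h).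
Qed.

Lemma val_lev t : (val (F t)).1 = (lev t)%:Z.
Proof.
rewrite /lev gez0_abs //; have /orP[/ltW //|/andP[/eqP -> _]] := gea_ge0 (F t).
by [].
Qed.

Lemma F_leE s t : (F s <= F t) = (lev s < lev t)%N || (lev s == lev t) && (gpart s <= gpart t).
Proof. by rewrite gea_leE !val_lev ltz_nat eqz_nat. Qed.

Lemma lev_le_k t : (lev t <= k)%N.
Proof.
have := gea_le1 (F t); rewrite val_lev ltz_nat eqz_nat => /orP[/ltnW //|/andP[/eqP -> _]].
by [].
Qed.

Lemma gpart_ge0 t : lev t = 0%N -> 0 <= gpart t.
Proof. by move=> l0; have := gea_ge0 (F t); rewrite val_lev l0. Qed.

Lemma gpart_le0 t : lev t = k -> gpart t <= 0.
Proof. by move=> l0; have := gea_le1 (F t); rewrite val_lev l0 ltxx eqxx. Qed.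

Lemma le_F s t : cw_le s t -> F s <= F t.
Proof.
move=> st; have [_] := sr_left_continuous F_sr s; apply => _ [r rs <-].
have [+ _] := sr_left_continuous F_sr t; apply; exists r => //=.
exact: cw_lt_le_trans st.
Qed.

Lemma le_lev s t : cw_le s t -> (lev s <= lev t)%N.
Proof. by move=> /le_F; rewrite F_leE => /orP[/ltnW|/andP[/eqP -> _]]. Qed.

Lemma le_gpart s t : cw_le s t -> lev s = lev t -> gpart s <= gpart t.
Proof. by move=> /le_F + e; rewrite F_leE e ltnn eqxx. Qed.

(** Isolates the degenerate case of the level lemmas. If a supremum or infimum skipped a level,
    bounds shifted by any [g >= 0] would force [g <= 0]; then [G] is trivial and [E] a finite
    chain. *)
Lemma directed_trivial : (forall g, 0 <= g -> g <= 0) -> forall g, g = 0.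
Proof.
move=> h; have h' g : g <= 0.
  by have [c gc c0] := G_dir g 0; exact: le_trans gc (h _ c0).
move=> g; apply/eqP; rewrite eq_le h' -(po_lerN2 G_po) oppr0.
exact: h'.
Qed.

(** If all values strictly below [t] had smaller level, each [(lev t, gpart t - g)] with [g >= 0]
    would bound them, so [G] is trivial; then already [((lev t).-1, 0)] bounds them. *)
Lemma lev_left t : exists2 r, cw_lt r t & lev r = lev t.
Proof.
apply: contrapT => no.
have lt r : cw_lt r t -> (lev r < lev t)%N.
  move=> rt; rewrite ltn_neqAle (le_lev (cw_lt_le rt)) andbT.
  by apply/eqP => e; apply: no; exists r.
have t_gt0 : (0 < lev t)%N.
  apply: leq_ltn_trans (leq0n _) (lt (\row_i (t 0 i - 1)) _).
  by move=> i; rewrite mxE gtrBl.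
have triv : forall g, g = 0.
  apply: directed_trivial => g g0.
  have [||a aE] := @gea_ex (lev t) (gpart t - g); first by rewrite t_gt0.
    have := lev_le_k t; rewrite leq_eqVlt => /orP[/eqP lk|->//].
    rewrite lk ltnn eqxx /= po_lerBlDr // add0r.
    exact: le_trans (gpart_le0 lk) g0.
  have : F t <= a.
    have [_] := sr_left_continuous F_sr t; apply => _ [r rt <-].
    by rewrite gea_leE aE val_lev ltz_nat lt.
  rewrite gea_leE aE val_lev ltxx eqxx /= po_lerBrDr // -/(gpart t).
  by rewrite -{2}[gpart t]addr0 po_lerD2l.
have [||a aE] := @gea_ex (lev t).-1 0.
- by rewrite lexx; case: (lev t).-1.
- by rewrite prednK // lev_le_k.
have : F t <= a.
  have [_] := sr_left_continuous F_sr t; apply => _ [r rt <-].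
  rewrite gea_leE aE val_lev ltz_nat eqz_nat /= -/(gpart r) (triv (gpart r)) lexx andbT.
  by rewrite orbC -leq_eqVlt -ltnS prednK // lt.
rewrite gea_leE aE val_lev /= ltz_nat eqz_nat => /orP[|/andP[/eqP + _]].
  by rewrite ltnNge leq_pred.
by move: t_gt0; case: (lev t) => // m _ /= /eqP; rewrite -[X in X == _]addn1 -[X in _ == X]addn0 eqn_add2l.
Qed.

(** If level [0] were never reached, every [(0, g)] with [g >= 0] would be a lower bound, so [G] is
    trivial; then [(1, 0)] is a lower bound, against (iii). *)
Lemma lev_eq0 i t : exists c, lev (update t i c) = 0%N.
Proof.
apply: contrapT => no.
have gt0 c : (0 < lev (update t i c))%N.
  by rewrite lt0n; apply/eqP => e; apply: no; exists c.
have triv : forall g, g = 0.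
  apply: directed_trivial => g g0.
  have [||a aE] := @gea_ex 0 g; [by rewrite g0|by rewrite k_ge1|].
  have [_ /(_ a)] := sr_inf F_sr i t; rewrite gea_leE aE /=; apply.
  by move=> _ [c _ <-]; rewrite gea_leE aE val_lev ltz_nat gt0.
have [||a aE] := @gea_ex 1 0; [by []|by rewrite lexx andbT orbC -leq_eqVlt|].
have [_ /(_ a)] := sr_inf F_sr i t; rewrite gea_leE aE /= => h.
suff : false by []; apply: h => _ [c _ <-].
rewrite gea_leE aE val_lev ltz_nat eqz_nat -/(gpart _) (triv (gpart _)) lexx andbT.
by rewrite orbC -leq_eqVlt gt0.
Qed.

Lemma lev_eqk : exists t, lev t = k.
Proof.
apply: contrapT => no.
have lt t : (lev t < k)%N.
  by rewrite ltn_neqAle lev_le_k andbT; apply/eqP => e; apply: no; exists t.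
have triv : forall g, g = 0.
  apply: directed_trivial => g g0.
  have [||a aE] := @gea_ex k (- g); first by rewrite k_ge1.
    by rewrite eqxx -(po_lerN2 G_po) oppr0 opprK g0 orbT.
  have [_ /(_ a)] := sr_sup F_sr; rewrite gea_leE aE /= ltxx eqxx -(po_lerN2 G_po) oppr0 opprK.
  by apply=> _ [t _ <-]; rewrite gea_leE aE val_lev ltz_nat lt.
have [||a aE] := @gea_ex k.-1 0.
- by rewrite lexx; case: k.-1.
- by rewrite prednK // leqnn.
have [_ /(_ a)] := sr_sup F_sr; rewrite gea_leE aE /= => h.
have : (k%:Z < k.-1%:Z) || (k%:Z == k.-1%:Z) && ((0 : G) <= 0).
  apply: h => _ [t _ <-]; rewrite gea_leE aE val_lev ltz_nat eqz_nat.
  by rewrite -/(gpart _) (triv (gpart _)) lexx andbT orbC -leq_eqVlt -ltnS prednK.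
rewrite ltz_nat eqz_nat lexx andbT; case: k k_ge1 => // m _ /=; lia.
Qed.

Lemma T_lev j t : T_ F j t <-> lev t = j.
Proof.
rewrite /T_ /layer /= val_lev.
by split => [/eqP|->] //; rewrite eqz_nat => /eqP.
Qed.

(** [lev_eq0] bounds the block of [s] below in each coordinate, and [lev_left] supplies a point of
    it strictly below [s]. *)
Lemma char_point_ex s : (0 < lev s)%N ->
  exists2 c, is_char_point F (lev s) c & cw_lt c s.
Proof.
move=> s_gt0; pose B := [set r | T_ F (lev s) r /\ T_ F (lev s) (cw_min r s)].
have Bs : B s by split; apply/T_lev; rewrite // cw_min_l.
have lbB i : has_lbound [set r 0 i | r in B].
  (* If [r] in the block had coordinate [i] below [c], then [cw_min r s] would lie under a point of
     level [0]. *)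
  have [c lc] := lev_eq0 i s; exists c => _ [r [_ /T_lev rs] <-].
  rewrite leNgt; apply/negP => rc; move: s_gt0; rewrite -rs lt0n -leqn0 -lc.
  move=> /negP; apply; apply: le_lev => j; rewrite !mxE.
  by case: eqVneq => [->|_]; rewrite ge_min ?(ltW rc) ?lexx ?orbT.
pose c : 'rV[R]_n := \row_i inf [set r 0 i | r in B].
exists c.
  exists B; first by exists s => //; apply/T_lev.
  move=> i; rewrite mxE; split; first exact: ge_inf.
  by move=> y yB; apply: lb_le_inf => //; exists (s 0 i), s.
move=> i; rewrite mxE; have [r rs rl] := lev_left s.
apply: le_lt_trans (rs i); apply: ge_inf => //; exists r => //.
by split; apply/T_lev => //; rewrite cw_min_l //; exact: cw_lt_le.
Qed.


(** By (v) the infimum of the values beyond [c] lies in layer [j] itself; its [G]-part is the bound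
    [g]. *)
Lemma char_point_bound j c : (1 <= j <= k)%N -> is_char_point F j c ->
  exists g, forall s, cw_lt c s -> (j < lev s)%N || (lev s == j) && (g <= gpart s).
Proof.
move=> jk [B bB cB]; have [a [ainf _] /= aj] := sr_char F_sr jk bB cB.
exists (val a).2 => s cs; have : a <= F s by apply: ainf; exists s.
by rewrite gea_leE aj val_lev ltz_nat eqz_nat [j == _]eq_sym.
Qed.

(** A layer has a single characteristic point by the ordering property, so one bound serves all its
    blocks. *)
Lemma gpart_lower j : exists g, forall s, lev s = j -> g <= gpart s.
Proof.
have [j0|j0] := posnP j; first by exists 0 => s; rewrite j0; exact: gpart_ge0.
have [[s0 s0j]|no] := pselect (exists s, lev s = j); last first.
  by exists 0 => s sj; case: no; exists s.
have jk : (1 <= j <= k)%N by rewrite j0 -s0j lev_le_k.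
have [|c] := @char_point_ex s0; first by rewrite s0j.
rewrite s0j => cc _; have [g gP] := char_point_bound jk cc.
exists g => s sj; have [|c'] := @char_point_ex s; first by rewrite sj.
rewrite sj => cc' c's; have /gP : cw_lt c s.
  have [F1 _] := F_ord; have T0 : T_ F j !=set0 by exists s0; apply/T_lev.
  by rewrite (F1 j jk T0 c c' cc cc').
by rewrite sj ltnn eqxx.
Qed.

(* [c] is the characteristic point of the least non-empty layer above [j]. *)
Lemma level_threshold j : (1 <= j <= k)%N ->
  exists c, forall s, (j <= lev s)%N <-> cw_lt c s.
Proof.
move=> /andP[j1 jk].
have ex : exists m, (j <= m)%N && `[< exists s, lev s = m >].
  by exists k; rewrite jk; apply/asboolP; exact: lev_eqk.
case: (ex_minnP ex) => m /andP[jm /asboolP[s0 s0m]] m_min.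
have mk : (1 <= m <= k)%N by rewrite (leq_trans j1 jm) -s0m lev_le_k.
have [|c] := @char_point_ex s0; first by rewrite s0m; case/andP: mk.
rewrite s0m => cc _; have [g gP] := char_point_bound mk cc.
exists c => s; split=> [js|/gP/orP[/ltnW|/andP[/eqP -> _] //]]; last exact: leq_trans.
have [|c' cc' c's] := @char_point_ex s; first exact: leq_trans js.
have : (m <= lev s)%N by apply: m_min; rewrite js; apply/asboolP; exists s.
rewrite leq_eqVlt => /orP[/eqP ms|ms].
  have [F1 _] := F_ord; have T0 : T_ F m !=set0 by exists s0; apply/T_lev.
  by rewrite -ms in cc'; rewrite (F1 m mk T0 c c' cc cc').
apply: cw_le_lt_trans c's; have [_ F2] := F_ord.
by apply: (F2 m (lev s)) => //; [case/andP: mk|rewrite ms lev_le_k].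
Qed.

(** [atom j] is the threshold of the levels above [j]; where levels are skipped, consecutive atoms
    coincide. *)
Lemma atoms_ex : exists atom : 'I_k -> 'rV[R]_n,
  forall (j : 'I_k) s, (j < lev s)%N <-> cw_lt (atom j) s.
Proof.
have ex (j : 'I_k) : exists c, forall s, (j < lev s)%N <-> cw_lt c s.
  by apply: (@level_threshold j.+1); rewrite ltn_ord.
by have [c cP] := choice ex; exists c.
Qed.

End Levels.

(** * Volumes of distribution functions of point masses *)

Section Indicators.
Variables (R : realType) (n : nat).
Implicit Types (p s t a b : 'rV[R]_n) (l : seq 'I_n).

Definition ltb p s : bool := [forall i, p 0 i < s 0 i].
Definition in_box a b p : bool := [forall i, a 0 i <= p 0 i < b 0 i].

Lemma ltbP p s : reflect (cw_lt p s) (ltb p s).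
Proof. exact: forallP. Qed.

Lemma in_boxP a b p : reflect (forall i, a 0 i <= p 0 i < b 0 i) (in_box a b p).
Proof. exact: forallP. Qed.

(** Coordinates already differenced test membership in the box, the others still compare with the
    base point; the induction needs this mixed form. *)
Lemma Deltas_indicator (K : zmodType) (g : K) p l a b t : uniq l -> cw_le a b ->
  Deltas l a b (fun s => g *+ ltb p s) t =
  g *+ [forall i, if i \in l then a 0 i <= p 0 i < b 0 i else p 0 i < t 0 i].
Proof.
move=> + ab; elim: l t => [|i l IH] t; first by [].
move=> /andP[il ul]; rewrite Deltas_cons !IH //.
pose rest := [forall j, (j == i) || if j \in l then a 0 j <= p 0 j < b 0 j else p 0 j < t 0 j].
have E c : [forall j, if j \in l then a 0 j <= p 0 j < b 0 j else p 0 j < update t i c 0 j] =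
    (p 0 i < c) && rest.
  apply/forallP/andP => [h|[h1 /forallP h2] j].
    split; first by have := h i; rewrite (negbTE il) update_eq.
    by apply/forallP => j; have := h j; case: eqVneq => //= ji; rewrite update_neq.
  have := h2 j; case: eqVneq => /= [-> _|ji]; first by rewrite (negbTE il) update_eq.
  by rewrite update_neq.
have -> : [forall j, if j \in i :: l then a 0 j <= p 0 j < b 0 j else p 0 j < t 0 j] =
    (a 0 i <= p 0 i < b 0 i) && rest.
  apply/forallP/andP => [h|[h1 /forallP h2] j].
    split; first by have := h i; rewrite mem_head.
    by apply/forallP => j; have := h j; rewrite in_cons; case: eqVneq.
  by rewrite in_cons; have := h2 j; case: eqVneq => //= ->.
rewrite !E; have := ab i; case: (rest); rewrite ?andbT ?andbF ?subrr //.
case: (ltP (p 0 i) (a 0 i)) => pa /= le; first by rewrite (lt_le_trans pa le) subrr.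
by rewrite subr0.
Qed.

Lemma Deltas_indicator_box (K : zmodType) (g : K) p a b t : cw_le a b ->
  Deltas (enum 'I_n) a b (fun s => g *+ ltb p s) t = g *+ in_box a b p.
Proof.
move=> ab; rewrite Deltas_indicator ?enum_uniq //; congr (g *+ nat_of_bool _).
by apply: eq_forallb => i; rewrite mem_enum.
Qed.

Lemma Deltas_swap (K : zmodType) i j l a b (f : 'rV[R]_n -> K) t :
  Deltas [:: i, j & l] a b f t = Deltas [:: j, i & l] a b f t.
Proof.
have [<-//|ij] := eqVneq i j.
rewrite !Deltas_cons !(updateC _ _ _ ij) !opprB addrACA [RHS]addrACA.
by congr (_ + _); rewrite addrC.
Qed.

Lemma Deltas_rem (K : zmodType) i l a b (f : 'rV[R]_n -> K) t : i \in l ->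
  Deltas l a b f t = Deltas (i :: rem i l) a b f t.
Proof.
elim: l t => // j l IH t; rewrite in_cons [rem _ _]/=; case: (eqVneq j i) => [->//|ji].
rewrite orFb => il.
by rewrite Deltas_swap Deltas_cons !IH // -Deltas_cons.
Qed.

Lemma Deltas_perm (K : zmodType) l l' a b (f : 'rV[R]_n -> K) t : perm_eq l l' ->
  Deltas l a b f t = Deltas l' a b f t.
Proof.
elim: l l' t => [|i l IH] l' t pl.
  by rewrite perm_sym in pl; rewrite (perm_small_eq _ pl).
have il' : i \in l' by rewrite -(perm_mem pl) mem_head.
have pl' : perm_eq l (rem i l').
  by rewrite -(perm_cons i); apply: perm_trans pl _; exact: perm_to_rem.
by rewrite [RHS](Deltas_rem _ _ _ _ il') !Deltas_cons !(IH _ _ pl').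
Qed.

End Indicators.

Lemma count_lt (T : eqType) (P Q : pred T) (s : seq T) x :
  subpred P Q -> x \in s -> Q x -> ~~ P x -> (count P s < count Q s)%N.
Proof.
move=> PQ; elim: s => // y s IH; rewrite in_cons /= => /orP[/eqP <-|xs] Qx Px.
  by rewrite Qx (negbTE Px) add0n add1n ltnS sub_count.
rewrite -addnS; apply: leq_add; last exact: IH.
by case Py : (P y) => //; rewrite PQ.
Qed.

(** * Order convergence to zero *)

Section NullSequences.
Variable G : porderZmodType.
Hypothesis G_po : po_group_law G.
Implicit Types x y z : nat -> G.

Definition null_seq x := exists z, [/\ nonincreasing_seq z, infimums (range z) 0 &
  exists m0, forall m, (m0 <= m)%N -> - z m <= x m /\ x m <= z m].

(** The sum of the two dominating sequences dominates; its infimum is [0] because a pair of indices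
    can be raised to their maximum. *)
Lemma null_seqB x y : null_seq x -> null_seq y -> null_seq (fun m => x m - y m).
Proof.
move=> [z [ndz [zlb zglb] [m0 zP]]] [w [ndw [wlb wglb] [m1 wP]]].
exists (fun m => z m + w m); split.
- by move=> m p mp; apply: po_lerD => //; [exact: ndz|exact: ndw].
- split; first by move=> _ [m _ <-]; apply: po_addr_ge0 => //; [apply: zlb|apply: wlb]; exists m.
  move=> y0 ylb; apply: zglb => _ [m _ <-]; rewrite -po_subr_ge0 // -po_lerN2 // oppr0 opprB.
  apply: wglb => _ [p _ <-]; rewrite po_lerBlDr //.
  apply: (@le_trans _ _ (z (maxn m p) + w (maxn m p))).
    by apply: ylb; exists (maxn m p).
  by rewrite addrC; apply: po_lerD => //; [apply: ndw; exact: leq_maxr|apply: ndz; exact: leq_maxl].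
- exists (maxn m0 m1) => m; rewrite geq_max => /andP[h0 h1].
  have [a1 a2] := zP m h0; have [b1 b2] := wP m h1.
  by rewrite opprD; split; apply: po_lerD => //; rewrite -po_lerN2 // ?opprK.
Qed.

Lemma null_seq_ge0 x g : null_seq x -> (exists m1, forall m, (m1 <= m)%N -> x m <= g) -> 0 <= g.
Proof.
move=> [z [ndz [zlb zglb] [m0 zP]]] [m1 xg].
rewrite -po_lerN2 // oppr0; apply: zglb => _ [m _ <-].
pose p := maxn m (maxn m0 m1).
apply: (@le_trans _ _ (z p)); last by apply: ndz; exact: leq_maxl.
rewrite -po_lerN2 // opprK; apply: (@le_trans _ _ (x p)).
  by have [] := zP p; rewrite // /p leq_max leq_maxl orbT.
by apply: xg; rewrite /p leq_max leq_maxr orbT.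
Qed.

End NullSequences.

(** * Removal of the point masses *)

Section RegularPart.
Variables (R : realType) (n k : nat) (G : porderZmodType).
Hypothesis k_ge1 : (1 <= k)%N.
Hypothesis G_po : po_group_law G.
Hypothesis G_dir : directed G.
Hypothesis G_msc : monotone_sigma_complete G.
Variable F : 'rV[R]_n -> Gamma_ea G k.
Hypothesis F_sr : is_spectral_resolution F.
Hypothesis F_ord : ordering_property F.
Variable atom : 'I_k -> 'rV[R]_n.
Hypothesis atomP : forall (j : 'I_k) s, (j < lev F s)%N <-> cw_lt (atom j) s.
Implicit Types (p r s t a b : 'rV[R]_n) (g : G).

Let lev := lev F.
Let f := gpart F.

Lemma lev_sum s : (lev s)%:Z = \sum_(j < k) 1 *+ ltb (atom j) s.
Proof.
have sumE m l : (\sum_(j < l) (j < m)%N)%N = minn m l.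
  elim: l => [|l IH]; first by rewrite big_ord0 minn0.
  by rewrite big_ord_recr /= IH; lia.
rewrite -[lev s](minn_idPl (lev_le_k F s)) -sumE -natz natr_sum; apply: eq_bigr => j _.
congr (1 *+ nat_of_bool _).
by apply/idP/ltbP => /atomP.
Qed.

Lemma Deltas_lev a b t : cw_le a b ->
  Deltas (enum 'I_n) a b (fun s => (lev s)%:Z) t = \sum_(j < k) 1 *+ in_box a b (atom j).
Proof.
move=> ab; rewrite (eq_Deltas_fun _ _ _ _ lev_sum) Deltas_sum.
by apply: eq_bigr => j _; rewrite Deltas_indicator_box.
Qed.

(** Without atoms the integer part of the volume is zero, and the lexicographic order hands (i) down
    to the [G]-part. *)
Lemma Deltas_gpart_ge0 a b t : cw_le a b -> (forall j, ~~ in_box a b (atom j)) ->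
  0 <= Deltas (enum 'I_n) a b f t.
Proof.
move=> ab no; have := sr_volume F_sr ab t; rewrite Zlex_leE.
have -> : (Delta_all a b (fun s => val (F s)) t).1 = Deltas (enum 'I_n) a b (fun s => (lev s)%:Z) t.
  rewrite -(@Deltas_morph _ _ (Zlex G) int fst) //.
  by apply: eq_Deltas_fun => s /=; rewrite val_lev.
rewrite Deltas_lev // big1 => [|j _]; last by rewrite (negbTE (no j)).
by rewrite ltxx eqxx /= -(@Deltas_morph _ _ (Zlex G) G snd).
Qed.

Lemma lev_pos_or s : lev s = 0%N -> forall j, ~~ ltb (atom j) s.
Proof. by move=> l0 j; apply/ltbP => /atomP; rewrite -/lev l0. Qed.

Definition cornerpt p (S : pred 'I_n) (e : R) : 'rV[R]_n :=
  \row_i (p 0 i + if S i then e else 0).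

Let shift p (e : R) : 'rV[R]_n := cornerpt p xpredT e.

Lemma cornerpt_le p S e e' : e <= e' -> cw_le (cornerpt p S e) (cornerpt p S e').
Proof. by move=> ee i; rewrite !mxE lerD2l; case: ifP. Qed.

(** The level is constant, at its minimum, for small [e]; on one level [gpart] is monotone and
    [gpart_lower] bounds it below. *)
Lemma gpart_corner_bounded p S : exists2 e0 : R, 0 < e0 &
  exists lo hi, forall e, 0 < e -> e <= e0 -> lo <= f (cornerpt p S e) /\ f (cornerpt p S e) <= hi.
Proof.
have ex : exists m, `[< exists2 e : R, 0 < e & lev (cornerpt p S e) = m >].
  by exists (lev (cornerpt p S 1)); apply/asboolP; exists 1.
case: (ex_minnP ex) => m /asboolP[e0 e00 e0m] m_min.
have [lo loP] := gpart_lower k_ge1 G_po G_dir F_sr F_ord m.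
exists e0 => //; exists lo, (f (cornerpt p S e0)) => e e1 e2.
have levE : lev (cornerpt p S e) = m.
  apply/eqP; rewrite eqn_leq -{1}e0m m_min ?andbT; last by apply/asboolP; exists e.
  by apply: le_lev => //; exact: cornerpt_le.
split; first exact: loP.
by apply: le_gpart => //; [exact: cornerpt_le|rewrite -/lev levE].
Qed.

(** Corner values enter with both signs, so a lower bound of the volume needs bounds of the corners
    from both sides. *)
Lemma Deltas_corner_bounded p l S : exists2 e0 : R, 0 < e0 &
  exists lo hi, forall e, 0 < e -> e <= e0 ->
    lo <= Deltas l p (shift p e) f (cornerpt p S e) /\
    Deltas l p (shift p e) f (cornerpt p S e) <= hi.
Proof.
elim: l S => [|i l IH] S; first exact: gpart_corner_bounded.
have [e1 e10 [lo1 [hi1 h1]]] := IH (predU (pred1 i) S).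
have [e2 e20 [lo2 [hi2 h2]]] := IH (predD S (pred1 i)).
exists (Num.min e1 e2); first by rewrite lt_min e10.
exists (lo1 - hi2), (hi1 - lo2) => e e0; rewrite le_min => /andP[ee1 ee2].
rewrite Deltas_cons.
have -> : update (cornerpt p S e) i (shift p e 0 i) = cornerpt p (predU (pred1 i) S) e.
  by apply/rowP => j; rewrite !mxE /=; case: eqVneq => [->|].
have -> : update (cornerpt p S e) i (p 0 i) = cornerpt p (predD S (pred1 i)) e.
  by apply/rowP => j; rewrite !mxE /= ?inE; case: eqVneq => [->|] /=; rewrite ?addr0.
have [a1 a2] := h1 e e0 ee1; have [b1 b2] := h2 e e0 ee2.
by split; apply: po_lerD => //; rewrite po_lerN2.
Qed.

Lemma atom_mass_ex : exists gamma : 'rV[R]_n -> G, forall p, exists2 e0 : R, 0 < e0 &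
  forall e, 0 < e -> e <= e0 -> gamma p <= Deltas (enum 'I_n) p (shift p e) f 0.
Proof.
have ex p : exists g, exists2 e0 : R, 0 < e0 &
    forall e, 0 < e -> e <= e0 -> g <= Deltas (enum 'I_n) p (shift p e) f 0.
  have [e0 e00 [lo [hi h]]] := Deltas_corner_bounded p (enum 'I_n) pred0.
  exists lo; exists e0 => // e e1 e2; have [+ _] := h e e1 e2.
  by rewrite (@Deltas_base _ _ _ _ _ _ _ _ 0) // => i; rewrite inE mem_enum.
by have [gamma gP] := choice ex; exists gamma.
Qed.

Variable gamma : 'rV[R]_n -> G.
Hypothesis gammaP : forall p, exists2 e0 : R, 0 < e0 &
  forall e, 0 < e -> e <= e0 -> gamma p <= Deltas (enum 'I_n) p (shift p e) f 0.

(** Coinciding atoms are merged: [gamma p] accounts for the whole [G]-part at [p], however many unit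
    masses sit there. *)
Definition atoms : seq 'rV[R]_n := undup [seq atom j | j <- enum 'I_k].

Lemma atomsP p : reflect (exists j, p = atom j) (p \in atoms).
Proof.
rewrite mem_undup; apply: (iffP mapP) => [[j _ ->]|[j ->]]; exists j => //.
by rewrite mem_enum.
Qed.

Definition regular s : G := f s - \sum_(p <- atoms) gamma p *+ ltb p s.

Lemma Deltas_regular a b t : cw_le a b -> Deltas (enum 'I_n) a b regular t =
  Deltas (enum 'I_n) a b f t - \sum_(p <- atoms) gamma p *+ in_box a b p.
Proof.
move=> ab; rewrite DeltasB Deltas_sum; congr (_ - _).
by apply: eq_bigr => p _; rewrite Deltas_indicator_box.
Qed.

Lemma volume_regular_small a b : cw_le a b ->
  (forall p, p \in atoms -> ~~ in_box a b p) -> 0 <= volume regular a b.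
Proof.
move=> ab no; rewrite (@volumeE _ _ _ _ _ _ 0) // Deltas_regular // big1_seq ?subr0.
  by apply: Deltas_gpart_ge0 => // j; apply: no; apply/atomsP; exists j.
by move=> p /andP[_ /no/negbTE ->].
Qed.

Lemma small_box p b : cw_lt p b -> exists2 e : R, 0 < e &
  [/\ cw_le (shift p e) b, gamma p <= Deltas (enum 'I_n) p (shift p e) f 0 &
      forall q, q \in atoms -> q != p -> ~~ in_box p (shift p e) q].
Proof.
move=> pb; have [e0 e00 he0] := gammaP p.
have [e1 e10 he1] : exists2 e1 : R, 0 < e1 & cw_le (shift p e1) b.
  exists (\big[Num.min/1]_i (b 0 i - p 0 i)).
    by apply: lt_bigmin => // i _; rewrite subr_gt0.
  by move=> i; rewrite mxE addrC -lerBrDr; exact: bigmin_le_cond.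
have [e2 e20 he2] : exists2 e2 : R, 0 < e2 &
    forall q, q \in atoms -> q != p -> ~~ in_box p (shift p e2) q.
  elim: atoms => [|q l [e e_gt0 he]]; first by exists 1.
  have [->|qp] := eqVneq q p.
    by exists e => // r; rewrite in_cons => /orP[/eqP -> /eqP//|]; exact: he.
  have /rowP : q <> p by exact/eqP.
  move=> /existsNP[i qi].
  have d0 : 0 < `|q 0 i - p 0 i| by rewrite normr_gt0 subr_eq0; exact/eqP.
  (* One coordinate in which [q] differs from [p] is enough to keep [q] out of a half-open box of
     that width. *)
  exists (Num.min e `|q 0 i - p 0 i|); first by rewrite lt_min e_gt0.
  move=> r; rewrite in_cons => /orP[/eqP -> _|rl rp].
    apply/in_boxP => /(_ i) /andP[h1]; rewrite mxE ltNge; apply/negP/negPn.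
    by rewrite -lerBrDl ge_min ger0_norm ?lexx ?orbT // subr_ge0.
  apply: contra (he r rl rp) => /in_boxP h; apply/in_boxP => j.
  have /andP[-> /lt_le_trans ->] // := h j.
  by rewrite !mxE lerD2l ge_min lexx.
exists (Num.min e0 (Num.min e1 e2)); first by rewrite !lt_min e00 e10.
split.
- apply: cw_le_trans he1; apply: cornerpt_le.
  by rewrite !ge_min lexx orbT.
- by apply: he0; rewrite ?lt_min ?e00 ?e10 // ge_min lexx.
- move=> q qA qp; apply: contra (he2 q qA qp) => /in_boxP h; apply/in_boxP => j.
  have /andP[-> /lt_le_trans ->] // := h j.
  by apply: cornerpt_le; rewrite !ge_min lexx !orbT.
Qed.

(* A box is cut along the faces of a small box around one of its atoms; the
   other pieces contain fewer atoms. *)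
Lemma volume_regular_ge0 a b : 0 <= volume regular a b.
Proof.
move: {2}(count (in_box a b) atoms) (leqnn (count (in_box a b) atoms)) => m.
elim: m a b => [|m IH] a b cm.
  have [ab|nab] := pselect (cw_le a b); last first.
    by move/existsNP: nab => [i /negP]; rewrite -ltNge => /ltW ba; rewrite (volume0 _ ba).
  apply: volume_regular_small => // p pA; apply/negP => pab.
  by move: cm; rewrite leqNgt -has_count => /hasP; apply; exists p.
have [ab|nab] := pselect (cw_le a b); last first.
  by move/existsNP: nab => [i /negP]; rewrite -ltNge => /ltW ba; rewrite (volume0 _ ba).
have [[p pA pab]|no] := pselect (exists2 p, p \in atoms & in_box a b p); last first.
  by apply: volume_regular_small => // p pA; apply/negP => pab; apply: no; exists p.
have ap : cw_le a p by move=> i; have /in_boxP/(_ i)/andP[] := pab.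
have pb : cw_lt p b by move=> i; have /in_boxP/(_ i)/andP[] := pab.
have [e e0 [eb ge no]] := small_box pb.
have pe : cw_le p (shift p e) by move=> i; rewrite mxE lerDl ltW.
have piece A B : cw_le a A -> cw_le B b -> ~~ in_box A B p -> 0 <= volume regular A B.
  move=> aA Bb npAB; apply: IH; rewrite -ltnS; apply: leq_trans cm.
  apply: (@count_lt _ _ _ _ p) => // q /in_boxP h; apply/in_boxP => i.
  have /andP[h1 h2] := h i.
  by rewrite (le_trans (aA i) h1) (lt_le_trans h2 (Bb i)).
suff chop l : volume regular (override l a p) (override l b (shift p e)) <= volume regular a b.
  apply: le_trans (chop (enum 'I_n)); rewrite !override_enum (@volumeE _ _ _ _ _ _ 0) //.
  rewrite Deltas_regular // (bigD1_seq p) ?undup_uniq //= big1_seq ?addr0.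
    rewrite (_ : in_box p (shift p e) p) ?mulr1n ?po_subr_ge0 //.
    by apply/in_boxP => i; rewrite lexx mxE ltrDl.
  by move=> q /andP[qp qA]; rewrite (negbTE (no q qA qp)).
elim: l => [|i l IHl]; first by rewrite !override_nil.
apply: le_trans IHl.
set A := override l a p; set B := override l b (shift p e).
have aA : cw_le a A by move=> j; rewrite mxE; case: ifP.
have Ap : cw_le A p by move=> j; rewrite mxE; case: ifP.
have Bb : cw_le B b by move=> j; rewrite mxE; case: ifP.
have eB : cw_le (shift p e) B by move=> j; rewrite [B 0 j]mxE; case: ifP.
rewrite !override_cons -/A -/B (volume_split i (p 0 i) _ A B).
have -> : Num.max (A 0 i) (p 0 i) = p 0 i by apply/max_idPr; exact: Ap.
rewrite (volume_split i (shift p e 0 i) _ (update A i (p 0 i)) B).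
have -> : Num.min (B 0 i) (shift p e 0 i) = shift p e 0 i by apply/min_idPr; exact: eB.
rewrite update_eq update_update.
have -> : Num.max (p 0 i) (shift p e 0 i) = shift p e 0 i by apply/max_idPr; exact: pe.
rewrite addrCA; apply: po_ler_wnDr => //; apply: po_addr_ge0 => //.
  apply: piece => //.
    by apply: cw_le_trans Bb => j; rewrite mxE; case: eqVneq => [->|//]; rewrite ge_min lexx.
  by apply/in_boxP => /(_ i) /andP[_]; rewrite update_eq lt_min ltxx andbF.
apply: piece => //.
  move=> j; rewrite [update _ _ _ _ _]mxE; case: eqVneq => [->|_]; last exact: aA.
  exact: le_trans (ap i) (pe i).
by apply/in_boxP => /(_ i) /andP[+ _]; rewrite update_eq mxE gerDl leNgt e0.
Qed.

Lemma ltb_lev s t : lev s = lev t -> forall p, p \in atoms -> ltb p s = ltb p t.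
Proof.
move=> st p /atomsP[j ->].
by apply/ltbP/ltbP => /atomP; rewrite -/lev ?st => h; apply/atomP; rewrite -/lev ?st.
Qed.

(** The atoms below a point depend on its level only, so within a level [regular] inherits limits
    from [f] up to a constant. *)
Lemma regular_lev s t : lev s = lev t -> regular s - f s = regular t - f t.
Proof.
move=> st; rewrite /regular [LHS]addrAC [RHS]addrAC !subrr !add0r; congr (- _).
by apply: eq_big_seq => p pA; rewrite (ltb_lev st pA).
Qed.

Lemma regular_lev0 s : lev s = 0%N -> regular s = f s.
Proof.
move=> s0; rewrite /regular big1_seq ?subr0 // => p /andP[_ /atomsP[j ->]].
by rewrite (negbTE (lev_pos_or s0 j)).
Qed.

Lemma regular_null i t : exists z : nat -> G, [/\ nonincreasing_seq z, infimums (range z) 0 &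
  exists m0, forall m, (m0 <= m)%N -> regular (update t i (- m%:R)) = z m].
Proof.
have [c lc] := lev_eq0 k_ge1 G_po G_dir F_sr i t.
pose m0 := (Num.truncn `|c|).+1.
have m0c : - m0%:R <= c.
  rewrite lerNl; apply: le_trans (ltW (truncnS_gt `|c|)).
  by rewrite -normrN ler_norm.
(* Starting at [m0] keeps the whole sequence in level [0], where no mass has been removed and (iii)
   speaks about [f]. *)
pose y (m : nat) := update t i (- (maxn m m0)%:R).
have ynd m q : (m <= q)%N -> cw_le (y q) (y m).
  move=> mp; apply: cw_le_update; rewrite lerN2 ler_nat; lia.
have yl m : lev (y m) = 0%N.
  apply/eqP; rewrite -leqn0 -lc; apply: le_lev => //; apply: cw_le_update.
  by apply: le_trans m0c; rewrite lerN2 ler_nat leq_maxr.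
have ndz : nonincreasing_seq (fun m => f (y m)).
  by move=> m q /ynd mp; apply: le_gpart => //; rewrite -/lev !yl.
have z0 : lbound (range (fun m => f (y m))) 0.
  by move=> _ [m _ <-]; exact: gpart_ge0.
exists (fun m => f (y m)); split => //.
  have [s [slb sglb]] := decreasing_inf G_po G_msc ndz z0.
  split => // x xlb; apply: le_trans (sglb _ xlb) _.
  have s0 : 0 <= s by exact: sglb.
  have [||a aE] := @gea_ex k G 0 s; [by rewrite s0|by rewrite k_ge1|].
  have [_ /(_ a)] := sr_inf F_sr i t; rewrite gea_leE aE /=; apply.
  move=> _ [d _ <-]; pose m := (Num.truncn `|d|).+1.
  apply: (@le_trans _ _ (F (y m))).
    by rewrite gea_leE aE val_lev -/lev yl eqxx /=; apply: slb; exists m.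
  apply: le_F => //; apply: cw_le_update.
  apply: (@le_trans _ _ (- m%:R)); first by rewrite lerN2 ler_nat leq_maxl.
  rewrite lerNl; apply: le_trans (ltW (truncnS_gt `|d|)).
  by rewrite -normrN ler_norm.
by exists m0 => m mm; rewrite -regular_lev0 // /y (maxn_idPl mm).
Qed.

Lemma Deltas_regular_null l i a b t : i \notin l ->
  null_seq (fun m : nat => Deltas l a b regular (update t i (- m%:R))).
Proof.
elim: l t => [|j l IH] t.
  move=> _; have [z [ndz infz [m0 zP]]] := regular_null i t.
  exists z; split => //; exists m0 => m mm /=; rewrite zP //; split => //.
  apply: (@le_trans _ _ 0); last by case: infz => + _; apply; exists m.
  by rewrite -po_lerN2 // opprK oppr0; case: infz => + _; apply; exists m.
rewrite in_cons negb_or => /andP[ij il].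
under eq_fun do rewrite Deltas_cons !(updateC _ _ _ ij).
by apply: null_seqB => //; exact: IH.
Qed.

(* A partial volume is a full one up to terms that vanish as the missing lower
   bounds tend to -oo. *)
Lemma Deltas_regular_ge0 l a b t : uniq l -> cw_le a b -> 0 <= Deltas l a b regular t.
Proof.
move: {2}(n - size l)%N (erefl (n - size l)%N) => d.
elim: d l a b t => [|d IH] l a b t dE ul ab.
  have pl : perm_eq l (enum 'I_n).
    apply: uniq_perm; rewrite ?enum_uniq //.
    have [] := @uniq_min_size _ l (enum 'I_n) ul.
    - by move=> i _; rewrite mem_enum.
    - by rewrite -cardE card_ord -subn_eq0 dE.
    by [].
  by rewrite (Deltas_perm _ _ _ _ pl) -(@volumeE _ _ _ _ _ _ t) //; exact: volume_regular_ge0.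
have [i il] : exists i, i \notin l.
  apply: contrapT => no.
  have : (n <= size l)%N.
    rewrite -[X in (X <= _)%N](card_ord n) cardE; apply: uniq_leq_size (enum_uniq _) _ => i _.
    by apply/negPn/negP => il; apply: no; exists i.
  lia.
apply: (null_seq_ge0 G_po (Deltas_regular_null a b t il)).
exists (Num.truncn `|t 0 i|).+1 => m mt.
have mle : - m%:R <= t 0 i.
  rewrite lerNl; apply: (@le_trans _ _ `|t 0 i|); first by rewrite -normrN ler_norm.
  by apply: le_trans (ltW (truncnS_gt _)) _; rewrite ler_nat.
rewrite -po_subr_ge0 //.
have := IH (i :: l) (update a i (- m%:R)) (update b i (t 0 i)) t.
rewrite Deltas_cons !update_eq update_id.
have off (u v : 'rV[R]_n) c : {in l, forall j, update u i c 0 j = u 0 j}.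
  by move=> j jl; rewrite update_neq //; apply: contraNneq il => <-.
rewrite (@eq_Deltas _ _ _ l _ a _ b); last 2 first.
- by move=> j jl; rewrite off.
- by move=> j jl; rewrite off.
apply => /=; [by rewrite subnS dE|by rewrite il|exact: cw_le_update2].
Qed.

Lemma le_regular s t : cw_le s t -> regular s <= regular t.
Proof.
move=> st; suff K l : regular s <= regular (override l s t).
  by have := K (enum 'I_n); rewrite override_enum.
elim: l => [|i l IH]; first by rewrite override_nil.
apply: (le_trans IH); rewrite override_cons.
have := @Deltas_regular_ge0 [:: i] (override l s t) (update (override l s t) i (t 0 i)) (override l s t).
rewrite Deltas_cons update_eq update_id po_subr_ge0 //; apply => //.
by move=> j; rewrite !mxE; case: eqVneq => [->|]; case: ifP.
Qed.

Lemma regular_inf i t : infimums (range (fun m : nat => regular (update t i (- m%:R)))) 0.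
Proof.
split; first by move=> _ [m _ <-]; exact: (@Deltas_regular_ge0 [::] t t).
have [z [ndz [_ zglb] [m0 zP]]] := regular_null i t.
move=> y ylb; apply: zglb => _ [m _ <-].
apply: le_trans (ndz _ _ (leq_maxl m m0)); rewrite -zP ?leq_maxr //.
by apply: ylb; exists (maxn m m0).
Qed.

Lemma regular_sup t : supremums (regular @` orthant t) (regular t).
Proof.
split; first by move=> _ [s st <-]; exact/le_regular/cw_lt_le.
move=> y yub.
have [r0 r0t lr0] := lev_left G_po G_dir F_sr t.
(* Points on the segment from [r0] to [t]; all have the level of [t], because [r0] already has
   it. *)
pose v (m : nat) : 'rV[R]_n := \row_i (t 0 i - (t 0 i - r0 0 i) / m.+1%:R).
have d0 i : 0 < t 0 i - r0 0 i by rewrite subr_gt0.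
have vt m : cw_lt (v m) t.
  by move=> i; rewrite mxE gtrBl divr_gt0 // ltr0n.
have vnd m q : (m <= q)%N -> cw_le (v m) (v q).
  move=> mp i; rewrite !mxE lerD2l lerN2 ler_pM2l // lef_pV2 ?posrE ?ltr0n //.
  by rewrite ler_nat ltnS.
have r0v m : cw_le r0 (v m).
  apply: cw_le_trans (vnd 0%N m _) => // i.
  by rewrite mxE divr1 opprB addrCA subrr addr0.
have lv m : lev (v m) = lev t.
  apply/eqP; rewrite eqn_leq le_lev //=; last exact: cw_lt_le.
  by rewrite /lev -{1}lr0 le_lev.
have vcof s : cw_lt s t -> exists m, cw_le s (v m).
  move=> st.
  have ex i : exists m : nat, (t 0 i - r0 0 i) / m.+1%:R <= t 0 i - s 0 i.
    have := @ltr_add_invr R 0 ((t 0 i - s 0 i) / (t 0 i - r0 0 i)).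
    rewrite divr_gt0 ?subr_gt0 // => /(_ isT)[m]; rewrite add0r => hm; exists m.
    by rewrite mulrC -ler_pdivlMr // ltW.
  have [w wP] := choice ex; exists (\max_i w i) => i.
  apply: (@le_trans _ _ (v (w i) 0 i)); last by apply: vnd; exact: (@leq_bigmax _ w).
  by rewrite mxE lerBrDr -lerBrDl.
have ndf : nondecreasing_seq (fun m => f (v m)).
  by move=> m q /vnd mp; apply: le_gpart => //; rewrite -/lev !lv.
have fub : ubound (range (fun m => f (v m))) (f t).
  by move=> _ [m _ <-]; apply: (le_gpart F_sr _ (lv m)); exact: cw_lt_le.
have [z [zub zlub]] := G_msc ndf (ex_intro _ _ fub).
have zt : z <= f t by exact: zlub.
(* [(lev t, z)] belongs to [E] and bounds all values strictly below [t], so (ii) yields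
   [f t <= z]. *)
have [||a aE] := @gea_ex k G (lev t) z.
- have [l0 /=|//] := posnP (lev t).
  apply: (@le_trans _ _ (f (v 0%N))); last by apply: zub; exists 0%N.
  by apply: gpart_ge0; rewrite -/lev lv.
- have := lev_le_k F t; rewrite -/lev leq_eqVlt => /orP[/eqP lk|->//].
  by rewrite lk ltnn eqxx /= (le_trans zt) // gpart_le0.
have : F t <= a.
  have [_] := sr_left_continuous F_sr t; apply => _ [s /vcof[m sm] <-].
  apply: (le_trans (le_F F_sr sm)); rewrite gea_leE aE val_lev -/lev lv eqxx /=.
  by rewrite ltxx; apply: zub; exists m.
rewrite gea_leE aE val_lev -/lev eqxx ltxx /= -/(gpart F t) -/f => tz.
have tE : regular t = f t + (regular t - f t) by rewrite addrCA subrr addr0.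
rewrite tE -po_lerBrDr //; apply: (le_trans tz); apply: zlub => _ [m _ <-].
rewrite po_lerBrDr // -(regular_lev (lv m)) addrCA subrr addr0.
by apply: yub; exists (v m) => //; exact: vt.
Qed.

(** Above any [t] there is a point of level [k], where all atoms are counted and [gpart] is
    nonpositive because the values lie under [(k, 0)]. *)
Lemma regular_bound t : regular t <= - \sum_(p <- atoms) gamma p.
Proof.
have [s sk] := lev_eqk k_ge1 G_po G_dir F_sr.
pose r : 'rV[R]_n := \row_i Num.max (s 0 i) (t 0 i).
have sr : cw_le s r by move=> i; rewrite mxE le_max lexx.
have tr : cw_le t r by move=> i; rewrite mxE le_max lexx orbT.
have rk : lev r = k.
  by apply/eqP; rewrite eqn_leq lev_le_k -{1}sk le_lev.
apply: (le_trans (le_regular tr)); rewrite /regular.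
rewrite (eq_big_seq gamma); last first.
  move=> p /atomsP[j ->]; rewrite (_ : ltb _ _) ?mulr1n //.
  by apply/ltbP/atomP; rewrite -/lev rk.
by rewrite -[leRHS]add0r po_lerD2r // gpart_le0.
Qed.

End RegularPart.

Lemma asboolU_disj (T : Type) (A B : set T) x : A `&` B = set0 ->
  (`[< (A `|` B) x >] = `[< A x >] + `[< B x >] :> nat)%N.
Proof.
move=> AB; have no : ~ (A x /\ B x) by move=> h; have [] : set0 x by rewrite -AB.
by case: (asboolP (A x)) => Ax; case: (asboolP (B x)) => Bx; case: asboolP => ABx //=;
  exfalso; move: ABx; rewrite /setU /=; tauto.
Qed.

(** * Uniqueness of the extension *)

Lemma observable_uniq (R : realType) (n k : nat) (G : porderZmodType)
  (x y : set 'rV[R]_n -> Gamma_ea G k) : is_observable x -> is_observable y ->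
  (forall t, y (orthant t) = x (orthant t)) -> forall A, borel A -> y A = x A.
Proof.
move=> ox oy xy; apply: (@borel_ind _ _ [set A | y A = x A]) => [|//|A B BA bA bB yA yB|A ndA bA yA] /=.
- by rewrite (obs_total ox) (obs_total oy).
- have dE (z : set 'rV[R]_n -> Gamma_ea G k) : is_observable z ->
      val (z (A `\` B)) = val (z A) - val (z B).
    move=> oz; rewrite -{2}(setDUK BA) setUC (obs_add oz (borelD bA bB) bB) ?addrK //.
    by apply/seteqP; split => r // [[]].
  by apply: val_inj; rewrite !dE // yA yB.
- have ndA' m : A m `<=` A m.+1 by apply/subsetPset/ndA.
  have := obs_sup oy bA ndA'; rewrite (_ : y \o A = x \o A); last first.
    by apply/funext => m; exact: yA.
  by move=> h; apply: is_subset1_supremums h (obs_sup ox bA ndA').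
Qed.

(** * The observable *)

Section Assembly.
Variables (R : realType) (n k : nat) (G : porderZmodType).
Hypothesis k_ge1 : (1 <= k)%N.
Hypothesis G_po : po_group_law G.
Hypothesis G_dir : directed G.
Variable F : 'rV[R]_n -> Gamma_ea G k.
Hypothesis F_sr : is_spectral_resolution F.
Variable atom : 'I_k -> 'rV[R]_n.
Hypothesis atomP : forall (j : 'I_k) s, (j < lev F s)%N <-> cw_lt (atom j) s.
Variables (gamma : 'rV[R]_n -> G) (mu : set 'rV[R]_n -> G).
Implicit Types (p r s t a b : 'rV[R]_n) (g : G) (A B : set 'rV[R]_n).

Let At := atoms atom.
Let H := regular F atom gamma.

Hypothesis muO : forall t, mu (orthant t) = H t.
Hypothesis mu_ge0 : forall A, borel A -> 0 <= mu A.
Hypothesis muU : forall A B, borel A -> borel B -> A `&` B = set0 -> mu (A `|` B) = mu A + mu B.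
Hypothesis mu_sup : forall A : nat -> set 'rV[R]_n, (forall m, borel (A m)) ->
  nondecreasing_seq A -> supremums (range (mu \o A)) (mu (\bigcup_m A m)).
Hypothesis H_bound : forall t, H t <= - \sum_(p <- At) gamma p.

(** The unit masses are counted with multiplicity, by index, whereas [atom_mass] runs over the
    distinct points. *)
Definition atom_count A : nat := \sum_(j < k) `[< A (atom j) >].
Definition atom_mass A : G := \sum_(p <- At) gamma p *+ `[< A p >].
Let wt A : Zlex G := ((atom_count A)%:Z, mu A + atom_mass A).

Let wtU A B : borel A -> borel B -> A `&` B = set0 -> wt (A `|` B) = wt A + wt B.
Proof.
move=> bA bB AB; congr (_, _).
  by rewrite -PoszD -big_split /=; congr Posz; apply: eq_bigr => j _; exact: asboolU_disj.
rewrite muU // addrACA -big_split /=; congr (_ + _); apply: eq_bigr => p _.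
by rewrite asboolU_disj // mulrnDr.
Qed.

(** A set that contains an atom is positive by its integer part, whatever the sign of [gamma]; on
    any other set only [mu] remains. *)
Let wt_ge0 A : borel A -> 0 <= wt A.
Proof.
move=> bA; rewrite Zlex_leE /=.
have [c0|c0] := posnP (atom_count A); last by rewrite ltz_nat c0.
rewrite c0 /= /atom_mass big1_seq ?addr0 ?mu_ge0 // => p /andP[_ /atomsP[j ->]].
move/eqP: c0; rewrite /atom_count sum_nat_eq0 => /forallP/(_ j) /=.
by case: `[< _ >].
Qed.

Let le_wt A B : borel A -> borel B -> A `<=` B -> wt A <= wt B.
Proof.
move=> bA bB AB.
rewrite -[in leRHS](setDUK AB) wtU //; first last.
- by apply/seteqP; split => x // [] Ax [].
- exact: borelD.
have := wt_ge0 (borelD bB bA); rewrite !Zlex_leE /= => /orP[h|/andP[/eqP h1 h2]].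
  by rewrite ltrDl h.
by rewrite -h1 addr0 ltxx eqxx /= po_ler_wnDr.
Qed.

Let le_mu A B : borel A -> borel B -> A `<=` B -> mu A <= mu B.
Proof.
move=> bA bB AB; rewrite -(setDUK AB) muU //.
- by apply: po_ler_wnDr => //; exact: mu_ge0 (borelD bB bA).
- exact: borelD.
- by apply/seteqP; split => x // [] Ax [].
Qed.

Let val_F t : val (F t) = ((lev F t)%:Z, gpart F t).
Proof. by rewrite -val_lev /gpart; case: (val (F t)). Qed.

Let wt_orthant t : wt (orthant t) = val (F t).
Proof.
have asE p : `[< orthant t p >] = ltb p t by apply/asboolP/ltbP => h; exact: h.
rewrite val_F (lev_sum k_ge1 atomP); congr (_, _).
  rewrite /atom_count -natz natr_sum; apply: eq_bigr => j _.
  by rewrite asE.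
have -> : atom_mass (orthant t) = \sum_(p <- At) gamma p *+ ltb p t.
  by apply: eq_bigr => p _; rewrite asE.
by rewrite muO /H /regular subrK.
Qed.

Let atom_massT : atom_mass setT = \sum_(p <- At) gamma p.
Proof. by apply: eq_bigr => p _; rewrite asboolT. Qed.

(** The bound on [H] gives [y <= 0]. Conversely [(k, y)] bounds the range of [F], whose supremum is
    [(k, 0)], so [0 <= y]. *)
Let wtT : wt setT = Zlex_unit G k.
Proof.
have countT : atom_count setT = k.
  rewrite /atom_count (eq_bigr (fun=> 1%N)) ?sum1_card ?card_ord // => j _.
  by rewrite asboolT.
rewrite /wt countT; congr (_, _); rewrite atom_massT; set y := _ + _.
have le_muT t : H t <= mu setT.
  by rewrite -muO; apply: le_mu => //; [exact: borel_orthant|exact: borelT].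
apply/eqP; rewrite eq_le.
have y0 : y <= 0.
  rewrite /y -po_lerBrDr // sub0r.
  have [_] := mu_sup (fun m => borel_orthant (cube_hi R n m)) (@nondecreasing_orthant_cube R n).
  rewrite bigcup_orthant_cube; apply => _ [m _ <-] /=; rewrite muO; exact: H_bound.
rewrite y0 /=.
have [||a aE] := @gea_ex k G k y; [by rewrite k_ge1|by rewrite eqxx y0 orbT|].
have [_ /(_ a)] := sr_sup F_sr; rewrite gea_leE aE /= ltxx eqxx; apply => _ [s _ <-].
rewrite gea_leE aE val_lev ltz_nat eqz_nat /=.
have := lev_le_k F s; rewrite leq_eqVlt => /orP[/eqP sk|->//].
rewrite sk ltnn eqxx /= -/(gpart F s) /y.
have -> : gpart F s = H s + \sum_(p <- At) gamma p.
  rewrite /H /regular (eq_big_seq gamma) ?subrK // => p /atomsP[j ->].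
  by rewrite (_ : ltb _ _) ?mulr1n //; apply/ltbP/atomP; rewrite sk.
by rewrite po_lerD2r.
Qed.

Let wt_le1 A : borel A -> wt A <= Zlex_unit G k.
Proof. by move=> bA; rewrite -wtT; apply: le_wt => //; exact: borelT. Qed.

(** The default, bottom, stands in when [wt A] leaves the interval, which no Borel set causes. *)
Definition extension A : Gamma_ea G k := insubd (Gamma_ea_bot G k) (wt A).

Let val_ext A : borel A -> val (extension A) = wt A.
Proof. by move=> bA; rewrite /extension insubdK // unfold_in wt_ge0 // wt_le1. Qed.

Lemma extension_orthant t : extension (orthant t) = F t.
Proof. by apply: val_inj; rewrite val_ext ?wt_orthant //; exact: borel_orthant. Qed.

Lemma extension_sup (A : nat -> set 'rV[R]_n) : (forall m, borel (A m)) ->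
  (forall m, A m `<=` A m.+1) -> supremums (range (extension \o A)) (extension (\bigcup_m A m)).
Proof.
move=> bA ndA; have bU := borel_bigcup bA.
have ndA' : nondecreasing_seq A by apply/nondecreasing_seqP => m; exact/subsetPset.
split.
  move=> _ [m _ <-] /=; rewrite gea_leE -Zlex_leE !val_ext //; apply: le_wt => //.
  exact: bigcup_sup.
move=> y yub.
(* There are finitely many atoms, so from some index on [A m] holds all atoms of the union and only
   [mu] still varies. *)
have [M hM] : exists M, forall m j, (M <= m)%N ->
    `[< A m (atom j) >] = `[< (\bigcup_m A m) (atom j) >].
  have ex j : exists m, (\bigcup_m A m) (atom j) -> A m (atom j).
    by have [[m _ h]|no] := pselect ((\bigcup_m A m) (atom j)); [exists m|exists 0%N].
  have [w wP] := choice ex; exists (\max_j w j) => m j jm.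
  apply: asbool_equiv_eq; split; first by exists m.
  move=> /wP; have /ndA'/subsetPset : (w j <= m)%N; last by apply.
  exact: leq_trans (@leq_bigmax _ w j) jm.
have cE m : (M <= m)%N -> atom_count (A m) = atom_count (\bigcup_m A m).
  by move=> mm; apply: eq_bigr => j _; rewrite hM.
have gE m : (M <= m)%N -> atom_mass (A m) = atom_mass (\bigcup_m A m).
  by move=> mm; apply: eq_big_seq => p /atomsP[j ->]; rewrite hM.
have le_y m : wt (A m) <= val y.
  by rewrite -val_ext // Zlex_leE -gea_leE; apply: yub; exists m.
suff : wt (\bigcup_m A m) <= val y by rewrite gea_leE -Zlex_leE val_ext.
have := le_y M; rewrite !Zlex_leE /= cE // => /orP[->//|/andP[/eqP ce _]].
rewrite ce eqxx ltxx /= -po_lerBrDr //.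
have [_] := mu_sup bA ndA'; apply => _ [m _ <-] /=; rewrite po_lerBrDr //.
have := le_y (maxn m M); rewrite Zlex_leE /= cE ?leq_maxr // ce ltxx eqxx /= gE ?leq_maxr //.
apply: le_trans; rewrite po_lerD2r //; apply: le_mu => //.
by apply/subsetPset/ndA'; exact: leq_maxl.
Qed.

Lemma extension_observable : is_observable extension.
Proof.
split; last exact: extension_sup.
  by apply: val_inj; rewrite val_ext ?wtT //; exact: borelT.
by move=> A B bA bB AB; rewrite !val_ext //; [exact: wtU|exact: borelU].
Qed.

End Assembly.

Theorem theorem4p3 (R : realType) (n k : nat) (G : porderZmodType)
  (n_ge1 : (1 <= n)%N) (k_ge1 : (1 <= k)%N)
  (G_po : po_group_law G) (G_dir : directed G)
  (G_msc : monotone_sigma_complete G) (G_int : interpolation G)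
  (F : 'rV[R]_n -> Gamma_ea G k)
  (F_sr : is_spectral_resolution F) (F_ord : ordering_property F) :
  exists x : set 'rV[R]_n -> Gamma_ea G k,
    [/\ is_observable x,
        forall t : 'rV[R]_n, x [set s | cw_lt s t] = F t
      & forall y : set 'rV[R]_n -> Gamma_ea G k,
          is_observable y ->
          (forall t : 'rV[R]_n, y [set s | cw_lt s t] = F t) ->
          forall A, borel A -> y A = x A].
Proof.
have G_arch : archimedean G by exact: archimedean_nonneg.
have [atom atomP] := atoms_ex k_ge1 G_po G_dir F_sr F_ord.
have [gamma gammaP] := atom_mass_ex k_ge1 G_po G_dir F_sr F_ord.
have [mu [muO mu_ge0 muU mu_sup]] := group_valued_measure G_po G_dir G_msc G_arch
  (* A coordinate that serves as the default direction of [cut]. *)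
  (Ordinal n_ge1)
  (@Deltas_regular_ge0 _ _ _ _ k_ge1 G_po G_dir G_msc _ F_sr _ atomP _ gammaP)
  (regular_bound k_ge1 G_po G_dir G_msc F_sr atomP gammaP)
  (regular_inf k_ge1 G_po G_dir G_msc F_sr atomP gammaP)
  (regular_sup k_ge1 G_po G_dir G_msc F_sr atomP gammaP).
have H_bound := regular_bound k_ge1 G_po G_dir G_msc F_sr atomP gammaP.
have ox := extension_observable k_ge1 G_po F_sr atomP muO mu_ge0 muU mu_sup H_bound.
have xF := extension_orthant k_ge1 G_po F_sr atomP muO mu_ge0 muU mu_sup H_bound.
exists (extension atom gamma mu); split => // y oy yF.
by apply: observable_uniq => // t; rewrite xF; exact: yF.
Qed.
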